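(* Let $X$ be a continuum with $\mathscr{H}^1(X)<+\infty$. Then there exists a path $\gamma:[0,1]\to X$ with the following properties: (i) $\gamma$ is closed, Lipschitz, surjective, and has degree zero; (ii) $m(\gamma,x)=2$ for $\mathscr{H}^1$-a.e. $x\in X$, and $\operatorname{length}(\gamma)=2\,\mathscr{H}^1(X)$; (iii) $\gamma$ has constant speed, equal to $2\,\mathscr{H}^1(X)$.
   Context: A continuum is a connected compact metric space. $\mathscr{H}^1$ is the one-dimensional Hausdorff measure, normalized as $\mathscr{H}^1(E)=\sup_{\delta>0}\inf\{\sum_i\operatorname{diam}(E_i)\}$, the infimum being over countable covers $\{E_i\}$ of $E$ with $\operatorname{diam}(E_i)\le\delta$. A path in a metric space $(X,d)$ is a continuous map $\gamma:I\to X$ with $I=[a_0,a_1]$ a closed interval; it is closed if $\gamma(a_0)=\gamma(a_1)$. Its multiplicity at $x\in X$ is $m(\gamma,x):=\#(\gamma^{-1}(x))\in[0,+\infty]$. Its length is $\operatorname{length}(\gamma)=\operatorname{length}(\gamma,I):=\sup\sum_{i=1}^n d(\gamma(t_{i-1}),\gamma(t_i))$ over all $n\ge1$ and all increasing sequences $t_0,\dots,t_n$ in $I$; for a closed interval $J\subset I$, $\operatorname{length}(\gamma,J)$ is the length of the restriction of $\gamma$ to $J$. The path $\gamma$ has constant speed, equal to the finite constant $c$, if $\operatorname{length}(\gamma,[t_0,t_1])=c(t_1-t_0)$ for every $[t_0,t_1]\subset I$. For a Lipschitz path $\gamma:I\to X$, a locally bounded Borel function $f:X\to\mathbb{R}$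 and a Lipschitz function $g:X\to\mathbb{R}$, set $\int_\gamma f\,dg:=\int_I (f\circ\gamma)\,\frac{d}{dt}(g\circ\gamma)\,dt$. A Lipschitz path $\gamma$ has degree zero if $\int_\gamma f\,dg=0$ for all Lipschitz functions $f,g:X\to\mathbb{R}$. *)

(* Defs.v *)
From HB Require Import structures.
From mathcomp Require Import all_boot all_order all_algebra.
From mathcomp Require Import all_classical all_reals all_analysis.

Set Implicit Arguments.
Unset Strict Implicit.
Unset Printing Implicit Defensive.

Import Order.TTheory GRing.Theory Num.Theory.
Import numFieldNormedType.Exports.

Local Open Scope classical_set_scope.
Local Open Scope ring_scope.

(* Nonemptiness is explicit: the empty set is [connected] in the library. *)
Definition continuum (R : realType) (X : metricType R) : Prop :=
  [/\ [set: X] !=set0, connected [set: X] & compact [set: X]].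

(* Adding 0 to the set of distances gives the empty set diameter 0, not -oo. *)
Definition diam (R : realType) (X : metricType R) (E : set X) : \bar R :=
  ereal_sup (0%E |` [set (mdist x y)%:E | x in E & y in E]).

(* Finite covers are included: they can be padded with empty sets. *)
Definition hausdorff1_pre (R : realType) (X : metricType R) (delta : R)
    (E : set X) : \bar R :=
  ereal_inf [set (\sum_(0 <= i <oo) diam (F i))%E | F in
    [set F : nat -> set X | E `<=` \bigcup_i F i /\
      forall i, (diam (F i) <= delta%:E)%E]].

Definition hausdorff1 (R : realType) (X : metricType R) (E : set X) : \bar R :=
  ereal_sup [set hausdorff1_pre delta E | delta in [set delta : R | 0 < delta]].

(* The type ascription [R^o] endows the reals with the distance |y - x|. *)
Definition lipschitz_map (R : realType) (X Y : metricType R) (A : set X)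
    (f : X -> Y) : Prop :=
  exists L : R, forall x y, A x -> A y -> mdist (f x) (f y) <= L * mdist x y.

(* A path on [a, b] is represented by a function on the whole line, of which  *)
(* only the restriction to [a, b] matters.                                    *)
Section paths.
Context {R : realType} {X : metricType R}.
Implicit Types (a b c : R) (gamma : R -> X).

Definition is_path a b gamma : Prop := {within `[a, b], continuous gamma}.

Definition closed_path a b gamma : Prop := gamma a = gamma b.

Definition lipschitz_path a b gamma : Prop :=
  @lipschitz_map R R^o X `[a, b] gamma.

Definition multiplicity a b gamma (x : X) : \bar R :=
  counting (`[a, b] `&` gamma @^-1` [set x]).

(* The t_i are weakly increasing: repeated points do not change the supremum, *)
(* and the length over a degenerate interval [a, a] is then 0.                *)
Definition path_length a b gamma : \bar R :=
  ereal_sup [set l | exists (n : nat) (t : nat -> R),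
    [/\ (0 < n)%N,
        forall i, (i <= n)%N -> t i \in `[a, b],
        forall i, (i < n)%N -> t i <= t i.+1 &
        l = (\sum_(i < n) mdist (gamma (t i)) (gamma (t i.+1)))%:E]].

Definition constant_speed a b gamma c : Prop :=
  forall t0 t1, a <= t0 -> t0 <= t1 -> t1 <= b ->
    path_length t0 t1 gamma = (c * (t1 - t0))%:E.

(* The derivative exists almost everywhere when g \o gamma is Lipschitz on    *)
(* [a, b]; the library's default value elsewhere does not affect the integral.*)
Definition path_integral a b gamma (f g : X -> R) : R :=
  \int[lebesgue_measure]_(t in `[a, b])
    ((f \o gamma) t * derive1 (g \o gamma) t).

Definition degree_zero a b gamma : Prop :=
  forall f g : X -> R,
    @lipschitz_map R X R^o setT f -> @lipschitz_map R X R^o setT g ->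
    path_integral a b gamma f g = 0.

End paths.

(* Main.v *)
(* Write H for the measure of X.  Starting from one point, repeatedly join a
   point not yet reached to the part already reached by a shortest arc.  Shortest
   arcs exist as limits of chains of points, and their measures add up to at most
   H.  Walking around the resulting tree gives closed chains of length at most
   2H, with arbitrarily small mesh, that cross every edge equally often in both
   directions.  Traversed at constant speed they subconverge to a closed
   2H-Lipschitz curve g onto X.  Since the trapezoidal sums of f dh vanish along
   these chains for all f and h, g has degree zero.

   Testing the degree against bumps f concentrated at x, with h the distance to a
   point of a countable dense set, shows that for almost every t either g(t) has a
   second preimage or all the functions h o g have derivative 0 at t; the image of
   the latter set of times is null.  So almost every point has at least two
   preimages.  On the other hand, covering X by the images of short intervals
   bounds the integral of the multiplicity by the length of g, which is at most
   2H.  Equality must therefore hold everywhere, which gives the multiplicity, the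
   length and the constant speed. *)

Require Import Defs.
From HB Require Import structures.
From mathcomp Require Import all_boot all_order all_algebra.
From mathcomp Require Import all_classical all_reals all_analysis.
From mathcomp Require Import measurable_realfun.
From mathcomp Require Import lra ring zify.

Set Implicit Arguments.
Unset Strict Implicit.
Unset Printing Implicit Defensive.

Import Order.TTheory GRing.Theory Num.Theory.
Import numFieldNormedType.Exports.

Local Open Scope classical_set_scope.
Local Open Scope ring_scope.

(** * Hausdorff measure as a metric outer measure *)

(** The construction stays discrete until the limit is taken because the derivatives of converging
    curves converge only weakly, so integrals of f dh along them are hard to follow. A trapezoidal
    sum over K pieces involves finitely many values of the curve and passes to a pointwise limit.
    Replacing a stretch of chain of length s by its two endpoints costs O(s^2), so the sum for the
    limit curve is O(1/K), and K is free to grow. The trapezoidal form changes sign when an edge is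
    reversed, which is why back-and-forth walks kill it.

    Minimality of the arcs serves to control measure: it makes each arc injective and disjoint from
    the part already reached except at its end, so that its length is at most the measure it adds.

    With P_j the set of points having at least j preimages, the closing squeeze is 2H + H1(P_3) <= 2
    H1(P_2) + H1(P_3) <= length <= 2H. Cutting the length at two times and applying the Lipschitz
    bound to the outer pieces turns it into constant speed. *)

Section diam.
Context {R : realType} {X : metricType R}.
Implicit Types (A B E : set X) (x y : X).

Lemma diam_ge0 E : (0 <= diam E)%E.
Proof. by apply: ereal_sup_ubound; left. Qed.

Lemma mdist_le_diam E x y : E x -> E y -> ((mdist x y)%:E <= diam E)%E.
Proof.
by move=> Ex Ey; apply: ereal_sup_ubound; right; exists x => //; exists y.
Qed.

Lemma diam_le E (c : \bar R) : (0 <= c)%E ->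
  (forall x y, E x -> E y -> ((mdist x y)%:E <= c)%E) -> (diam E <= c)%E.
Proof.
move=> c0 Ec; apply: ge_ereal_sup => _ [->//|[x Ex [y Ey <-]]].
exact: Ec.
Qed.

Lemma diam0 : diam (@set0 X) = 0%E.
Proof. by apply/eqP; rewrite eq_le diam_ge0 andbT; exact: diam_le. Qed.

Lemma le_diam A B : A `<=` B -> (diam A <= diam B)%E.
Proof.
move=> AB; apply: diam_le; first exact: diam_ge0.
by move=> x y /AB Bx /AB By; exact: mdist_le_diam.
Qed.

End diam.

(** Records a point in the type, so that a nonempty space becomes a pointed type to which the
    measure constructions apply. *)
Definition pointed_at (T : Type) (t : T) : Type := T.
HB.instance Definition _ (T : choiceType) (t : T) :=
  Choice.copy (pointed_at t) T.
HB.instance Definition _ (T : choiceType) (t : T) :=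
  isPointed.Build (pointed_at t) t.

Section hausdorff.
Context {R : realType} {X : metricType R}.
Implicit Types (A B E : set X) (x y : X) (F : nat -> set X) (delta : R).
Local Open Scope ereal_scope.

Lemma hausdorff1_preP delta E F : E `<=` \bigcup_i F i ->
  (forall i, diam (F i) <= delta%:E) ->
  hausdorff1_pre delta E <= \sum_(0 <= i <oo) diam (F i).
Proof. by move=> EF Fd; apply: ereal_inf_lbound; exists F. Qed.

Lemma hausdorff1_pre_ge delta E (c : \bar R) :
  (forall F, E `<=` \bigcup_i F i -> (forall i, diam (F i) <= delta%:E) ->
    c <= \sum_(0 <= i <oo) diam (F i)) -> c <= hausdorff1_pre delta E.
Proof. by move=> h; apply: le_ereal_inf_tmp => _ [F [EF Fd] <-]; exact: h. Qed.

Lemma hausdorff1_pre_le delta E : (0 < delta)%R ->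
  hausdorff1_pre delta E <= hausdorff1 E.
Proof. by move=> d0; apply: ereal_sup_ubound; exists delta. Qed.

Lemma hausdorff1_le E (c : \bar R) :
  (forall delta, (0 < delta)%R -> hausdorff1_pre delta E <= c) ->
  hausdorff1 E <= c.
Proof. by move=> h; apply: ge_ereal_sup => _ [d d0 <-]; exact: h. Qed.

Lemma le_hausdorff1_pre delta delta' A B : (delta' <= delta)%R -> A `<=` B ->
  hausdorff1_pre delta A <= hausdorff1_pre delta' B.
Proof.
move=> dd AB; apply: hausdorff1_pre_ge => F BF Fd.
apply: hausdorff1_preP; first exact: subset_trans BF.
by move=> i; rewrite (le_trans (Fd i))// lee_fin.
Qed.

Lemma hausdorff1_pre_ge0 delta E : 0 <= hausdorff1_pre delta E.
Proof.
by apply: hausdorff1_pre_ge => F _ _; apply: nneseries_ge0 => *; exact: diam_ge0.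
Qed.

Lemma hausdorff1_pre0 delta : (0 < delta)%R ->
  hausdorff1_pre delta (@set0 X) = 0.
Proof.
move=> d0; apply/eqP; rewrite eq_le hausdorff1_pre_ge0 andbT.
rewrite (le_trans (@hausdorff1_preP _ _ (fun=> set0) _ _))//.
  by move=> i; rewrite diam0 lee_fin ltW.
by rewrite eseries0// => i _; rewrite diam0.
Qed.

(* [hausdorff1_pre delta] is the outer measure that [mu_ext] builds from the
   gauge below on the sigma-algebra of all sets. *)
Lemma hausdorff1_pre_sigma_subadditive delta : (0 < delta)%R ->
  sigma_subadditive (@hausdorff1_pre R X delta).
Proof.
move=> d0 F.
have [[x]|F0] := pselect (exists x, (\bigcup_n F n) x); last first.
  have -> : \bigcup_n F n = set0.
    by apply/seteqP; split => // x Fx; apply: F0; exists x.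
  rewrite hausdorff1_pre0//.
  by apply: nneseries_ge0 => *; exact: hausdorff1_pre_ge0.
move=> _.
pose T := g_sigma_algebraType (@setT (set (pointed_at x))).
(* The value [+oo] on sets of diameter above [delta] makes every cover that uses one infinitely
   expensive, which encodes the size constraint of [hausdorff1_pre] in the gauge. *)
pose gauge (E : set T) : \bar R :=
  if (diam (E : set X) <= delta%:E) then diam (E : set X) else +oo.
have gauge0 : gauge set0 = 0 by rewrite /gauge diam0 lee_fin ltW.
have gauge_ge0 (E : set T) : 0 <= gauge E.
  by rewrite /gauge; case: ifP => // _; exact: diam_ge0.
have mT (E : set T) : measurable E by exact: sub_sigma_algebra.
suff preE (E : set T) : hausdorff1_pre delta (E : set X) = mu_ext gauge E.
  rewrite preE; apply: le_trans (mu_ext_sigma_subadditive gauge_ge0 F) _.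
  apply: lee_nneseries => i _; first by move=> _; rewrite -preE; exact: hausdorff1_pre_ge0.
  by rewrite preE.
apply/eqP; rewrite eq_le; apply/andP; split.
- apply: le_ereal_inf_tmp => _ [A [_ EA] <-].
  have [Ad|/existsNP[i /negP Ai]] := pselect (forall i, diam (A i : set X) <= delta%:E).
    rewrite (le_trans (hausdorff1_preP EA Ad))//.
    apply: lee_nneseries => i _; first by move=> _; exact: diam_ge0.
    by rewrite /gauge Ad.
  rewrite (@nneseries_pinfty _ (gauge \o A) xpredT i) ?leey//=.
  by rewrite /gauge (negbTE Ai).
- apply: hausdorff1_pre_ge => A EA Ad.
  rewrite (_ : (fun n => _) = (fun n => \sum_(0 <= i < n) gauge (A i))).
    by apply: ereal_inf_lbound; exists A.
  by apply/funext => n; apply: eq_bigr => i _; rewrite /gauge Ad.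
Qed.

Lemma hausdorff1_ge0 E : 0 <= hausdorff1 E.
Proof.
by apply: le_trans (hausdorff1_pre_ge0 1 E) _; exact: hausdorff1_pre_le.
Qed.

Lemma hausdorff1_0 : hausdorff1 (@set0 X) = 0.
Proof.
apply/eqP; rewrite eq_le hausdorff1_ge0 andbT.
by apply: hausdorff1_le => d d0; rewrite hausdorff1_pre0.
Qed.

Lemma le_hausdorff1 A B : A `<=` B -> hausdorff1 A <= hausdorff1 B.
Proof.
move=> AB; apply: hausdorff1_le => d d0.
by apply: le_trans (hausdorff1_pre_le _ d0); exact: le_hausdorff1_pre.
Qed.

Lemma hausdorff1_sigma_subadditive : sigma_subadditive (@hausdorff1 R X).
Proof.
move=> F; apply: hausdorff1_le => d d0.
apply: le_trans (hausdorff1_pre_sigma_subadditive d0 F) _.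
apply: lee_nneseries => i _; first by move=> _; exact: hausdorff1_pre_ge0.
exact: hausdorff1_pre_le.
Qed.

HB.instance Definition _ := isOuterMeasure.Build R X (@hausdorff1 R X)
  hausdorff1_0 hausdorff1_ge0 le_hausdorff1 hausdorff1_sigma_subadditive.

(** At scales below [r] no covering set meets both [A] and [B], so a cover of the union splits into
    a cover of each at no extra cost. *)
Lemma hausdorff1_separated A B (r : R) : (0 < r)%R ->
  (forall x y, A x -> B y -> (r <= mdist x y)%R) ->
  hausdorff1 A + hausdorff1 B <= hausdorff1 (A `|` B).
Proof.
move=> r0 sep.
have pre (d : R) : (0 < d)%R -> (d < r)%R ->
    hausdorff1_pre d A + hausdorff1_pre d B <= hausdorff1_pre d (A `|` B).
  move=> d0 dr; apply: hausdorff1_pre_ge => F ABF Fd.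
  (* [FA i] is [F i] if [F i] meets [A], and empty otherwise; likewise [FB i]. *)
  pose FA i := F i `&` [set x | exists2 y, F i y & A y].
  pose FB i := F i `&` [set x | exists2 y, F i y & B y].
  apply: (@le_trans _ _ (\sum_(0 <= i <oo) (diam (FA i) + diam (FB i)))).
    rewrite nneseriesD; try by move=> *; exact: diam_ge0.
    apply: leeD; apply: hausdorff1_preP.
    - move=> x Ax; have [i _ Fx] := ABF x (or_introl Ax); exists i => //.
      by split => //; exists x.
    - by move=> i; apply: le_trans (Fd i); apply: le_diam => x [].
    - move=> x Bx; have [i _ Fx] := ABF x (or_intror Bx); exists i => //.
      by split => //; exists x.
    - by move=> i; apply: le_trans (Fd i); apply: le_diam => x [].
  apply: lee_nneseries; first by move=> *; apply: adde_ge0; exact: diam_ge0.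
  move=> i _; have [[x Fx Ax]|nA] := pselect (exists2 x, F i x & A x).
    have -> : FB i = set0.
      rewrite -subset0 => z [_ [y Fy By]].
      have := le_trans (mdist_le_diam Fx Fy) (Fd i).
      by rewrite lee_fin leNgt (lt_le_trans dr)// sep.
    by rewrite diam0 adde0; apply: le_diam => z [].
  have -> : FA i = set0 by rewrite -subset0 => z [_].
  by rewrite diam0 add0e; apply: le_diam => z [].
have [Hoo|Hfin] := eqVneq (hausdorff1 (A `|` B)) +oo; first by rewrite Hoo leey.
have fin (C : set X) : C `<=` A `|` B -> hausdorff1 C \is a fin_num.
  move=> CAB; rewrite ge0_fin_numE ?hausdorff1_ge0//.
  by rewrite (le_lt_trans (le_hausdorff1 CAB))// ltey.
have finpre (d : R) (C : set X) : (0 < d)%R -> C `<=` A `|` B ->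
    hausdorff1_pre d C \is a fin_num.
  move=> d0 CAB; rewrite ge0_fin_numE ?hausdorff1_pre_ge0//.
  rewrite (le_lt_trans (hausdorff1_pre_le _ d0))//.
  by rewrite -ge0_fin_numE ?hausdorff1_ge0// fin.
have AAB : A `<=` A `|` B by exact: subsetUl.
have BAB : B `<=` A `|` B by exact: subsetUr.
(* The two measures are suprema over unrelated scales [d1] and [d2]. Each is bounded with the other
   summand moved to the right, which is where finiteness enters; then a common smaller scale is
   chosen. *)
rewrite -leeBrDr ?fin//; apply: hausdorff1_le => d1 d10.
rewrite leeBrDr ?fin// addeC -leeBrDr ?finpre//.
apply: hausdorff1_le => d2 d20; rewrite leeBrDr ?finpre//.
pose d : R := Num.min (Num.min d1 d2) (r / 2)%R.
have d0 : (0 < d)%R by rewrite !lt_min d10 d20 divr_gt0.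
apply: le_trans (hausdorff1_pre_le _ d0).
apply: le_trans (pre _ d0 _); last by rewrite !gt_min; apply/orP; right; lra.
rewrite addeC; apply: leeD; apply: le_hausdorff1_pre => //.
  by rewrite !ge_min lexx.
by rewrite !ge_min lexx orbT.
Qed.

End hausdorff.

(** * Closed sets are Caratheodory measurable *)

Section hausdorff_measurable.
Context {R : realType} {X : metricType R}.
Implicit Types (A B C E : set X) (x y : X).
Local Open Scope ereal_scope.

(* The shells of A at distance about 1/k from C: shells whose indices differ by
   at least 2 are a positive distance apart, so the series of their measures
   converges. *)
Lemma closed_caratheodory C : closed C ->
  caratheodory_measurable (@hausdorff1 R X) C.
Proof.
move=> cC; apply: le_caratheodory_measurable => A /=.
have [Aoo|Afin] := eqVneq (hausdorff1 A) +oo; first by rewrite Aoo leey.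
have H1fin E : E `<=` A -> hausdorff1 E \is a fin_num.
  move=> EA; rewrite ge0_fin_numE ?hausdorff1_ge0//.
  by rewrite (le_lt_trans (le_hausdorff1 EA))// ltey.
pose D k := [set x | forall c, C c -> (k.+1%:R^-1 <= mdist x c)%R].
have D_sep k E E' : E `<=` D k -> E' `&` D k.+1 = set0 ->
    hausdorff1 E + hausdorff1 E' <= hausdorff1 (E `|` E').
  move=> ED E'D; have r0 : (0 < k.+1%:R^-1 - k.+2%:R^-1 :> R)%R.
    by rewrite subr_gt0 ltf_pV2 ?posrE// ltr_nat.
  apply: (hausdorff1_separated r0) => x y Ex E'y.
  have /existsNP[c /not_implyP[Cc /negP]] : ~ D k.+1 y.
    by move=> Dy; have : set0 y by rewrite -E'D.
  rewrite -ltNge => yc; have := ED _ Ex _ Cc.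
  have := metric_triangle x y c.
  move: yc; move: (_^-1)%R (_^-1)%R => a b; lra.
have subD j k : (j <= k)%N -> D j `<=` D k.
  move=> jk x Dx c /Dx; apply: le_trans.
  by rewrite lef_pV2 ?posrE// ler_nat.
pose S k := A `&` (D k.+1 `\` D k).
have SA k : S k `<=` A by move=> x [].
have sumS p n : \sum_(i < n) hausdorff1 (S (p + i.*2)%N) <= hausdorff1 A.
  pose U n := \big[setU/set0]_(i < n) S (p + i.*2)%N.
  have US m : U m = [set x | exists2 i, (i < m)%N & S (p + i.*2)%N x].
    rewrite /U -(bigcup_mkord m (fun i => S (p + i.*2)%N)).
    by apply/seteqP; split => x /= [i ? ?]; exists i.
  suff : \sum_(i < n) hausdorff1 (S (p + i.*2)%N) <= hausdorff1 (U n).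
    move=> /le_trans; apply; apply: le_hausdorff1; rewrite US.
    by move=> x [i _ []].
  elim: n => [|n IH]; first by rewrite big_ord0 hausdorff1_ge0.
  rewrite big_ord_recr/= /U big_ord_recr/= -/(U n).
  apply: le_trans (leeD2r _ IH) _.
  case: n {IH} => [|n]; first by rewrite /U big_ord0 set0U hausdorff1_0 add0e.
  apply: (D_sep (p + n.*2.+1)%N).
    rewrite US => x [i]; rewrite ltnS => iN [_ [+ _]]; apply: subD.
    by rewrite -addnS leq_add2l ltnS leq_double.
  by rewrite -subset0 => x [[_ [_]]]; rewrite -addnS.
have Sfin : \sum_(0 <= k <oo) hausdorff1 (S k) < +oo.
  have bound n : \sum_(0 <= k < n) hausdorff1 (S k) <= hausdorff1 A + hausdorff1 A.
    apply: (@le_trans _ _ (\sum_(0 <= k < n.*2) hausdorff1 (S k))).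
      apply: lee_sum_nneg_natr => //; last by rewrite -addnn leq_addr.
      by move=> *; exact: hausdorff1_ge0.
    (* Neighbouring shells may touch, so even and odd indices are summed apart, each sum being at
       most the measure of [A]. *)
    suff -> : \sum_(0 <= k < n.*2) hausdorff1 (S k) =
        \sum_(i < n) hausdorff1 (S (0 + i.*2)%N) +
        \sum_(i < n) hausdorff1 (S (1 + i.*2)%N) by exact: leeD.
    rewrite -big_split/=; elim: n => [|n IH]; first by rewrite big_geq// big_ord0.
    by rewrite doubleS 2?big_nat_recr//= IH big_ord_recr/= -addeA.
  apply: (@le_lt_trans _ _ (hausdorff1 A + hausdorff1 A)).
    apply: lime_le; last by near=> n; exact: bound.
    by apply: is_cvg_nneseries => *; exact: hausdorff1_ge0.
  by rewrite -ge0_fin_numE ?adde_ge0 ?hausdorff1_ge0// fin_numD H1fin.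
have tail := nneseries_tail_cvg Sfin (fun k _ => hausdorff1_ge0 (S k)).
apply/lee_addgt0Pr => e e0.
have [N tailN] : exists N, \sum_(N <= k <oo) hausdorff1 (S k) <= e%:E.
  move/fine_cvgP : tail => [[N1 _ Sf] /cvgrPdist_le /(_ _ e0)[N2 _ Se]].
  exists (maxn N1 N2); rewrite -(fineK (Sf _ (leq_maxl N1 N2))) lee_fin.
  by apply: le_trans (Se _ (leq_maxr N1 N2)); rewrite sub0r normrN ler_norm.
(* A point off the closed set [C] lies in some [D M]; descending from [M], it either lies in [D N]
   already or enters at a shell [S k] with k >= N. *)
have AC : A `&` ~` C `<=` (A `&` D N) `|` \bigcup_(k in ~` `I_N) S k.
  move=> x [Ax Cx].
  have [M] : exists M, D M x.
    have : nbhs x (~` C) by apply: open_nbhs_nbhs; split => //; exact: closed_openC.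
    rewrite -nbhs_ballE => -[r /= r0 xrC].
    have [M Mr] := @ltr_add_invr R 0 r r0.
    exists M => c Cc; rewrite leNgt; apply/negP => xc.
    apply: (xrC c) => //; rewrite ballEmdist/=.
    by rewrite (lt_trans xc)// -[ltLHS]add0r.
  elim: M => [|M IH] DM; first by left; split => //; exact: subD DM.
  have [/IH//|DMx] := pselect (D M x).
  have [NM|MN] := leqP N M; first by right; exists M => //=; rewrite ltnNge NM.
  by left; split => //; exact: subD DM.
apply: (@le_trans _ _ (hausdorff1 (A `&` C) +
    (hausdorff1 (A `&` D N) + e%:E))).
  rewrite leeD2l//; apply: le_trans (le_hausdorff1 AC) _.
  apply: le_trans (outer_measureU2 _ _ _) _ => /=.
  rewrite leeD2l//; apply: le_trans tailN.
  exact: outer_measure_sigma_subadditive_tail.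
rewrite addeA leeD2r// addeC.
apply: le_trans (D_sep N _ _ _ _) _ => //.
  rewrite -subset0 => x [[_ Cx]] /(_ x Cx).
  by rewrite mdistxx leNgt invr_gt0 ltr0n.
by apply: le_hausdorff1 => x [] [].
Unshelve. all: by end_near. Qed.

End hausdorff_measurable.

(** * Lower bounds for the Hausdorff measure by 1-Lipschitz functions *)

Section lower_bounds.
Context {R : realType} {X : metricType R}.
Implicit Types (A B C E : set X) (x y : X).

Lemma lipschitz_real_continuous (f : X -> R) (L : R) :
  (forall x y, `|f x - f y| <= L * mdist x y) -> continuous f.
Proof.
move=> fL x; apply/cvgrPdist_lt => e e0.
have L0 : 0 < `|L| + 1 by rewrite ltr_wpDl.
have := nbhsx_ballx x (e / (`|L| + 1)) (divr_gt0 e0 L0).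
apply: filterS => y; rewrite ballEmdist/= ltr_pdivlMr// => xy.
apply: le_lt_trans (fL x y) _; apply: le_lt_trans xy.
rewrite mulrC ler_wpM2l ?mdist_ge0// (le_trans (ler_norm L))//.
by rewrite lerDl.
Qed.

Lemma lipschitz_curve_continuous (g : R -> X) (L : R) :
  (forall s t, mdist (g s) (g t) <= L * `|t - s|) -> continuous g.
Proof.
move=> gL x; apply/metricType_numDomainType.cvgrPdist_lt => e e0.
have L0 : 0 < `|L| + 1 by rewrite ltr_wpDl.
have := nbhsx_ballx x (e / (`|L| + 1)) (divr_gt0 e0 L0).
apply: filterS => y; rewrite /ball/= distrC ltr_pdivlMr// => xy.
apply: le_lt_trans (gL x y) _; apply: le_lt_trans xy.
by rewrite mulrC ler_wpM2l// (le_trans (ler_norm L))// lerDl.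
Qed.

Lemma mdist_dist a x y : `|mdist a x - mdist a y| <= mdist x y.
Proof.
have := metric_triangle a x y; have := metric_triangle a y x.
by rewrite (metric_sym y x) ler_distlC; lra.
Qed.

Lemma mdist_continuous a : continuous (mdist a : X -> R).
Proof.
apply: (@lipschitz_real_continuous _ 1) => x y; rewrite mul1r; exact: mdist_dist.
Qed.

(** A 1-Lipschitz function sends each covering set into an interval no longer than its diameter.
    These intervals cover [0, r[, and subadditivity of Lebesgue measure concludes. *)
Lemma hausdorff1_lipschitz_ge A (f : X -> R) (r : R) :
  (forall x y, `|f x - f y| <= mdist x y) ->
  (forall t, 0 <= t -> t < r -> exists2 x, A x & f x = t) ->
  (r%:E <= hausdorff1 A)%E.
Proof.
move=> f1 fA; have [r0|r0] := leP r 0.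
  by apply: le_trans (hausdorff1_ge0 A); rewrite lee_fin.
apply: le_trans (hausdorff1_pre_le _ ltr01).
apply: hausdorff1_pre_ge => F AF F1.
pose m i := inf (f @` F i).
(* An interval of length [diam (F i)] containing the image of [F i]; unlike the image it is
   certainly measurable. *)
pose I i : set R :=
  if pselect (F i !=set0) then `[m i, m i + fine (diam (F i))]%classic else set0.
have Ffin i : diam (F i) \is a fin_num.
  by rewrite ge0_fin_numE ?diam_ge0// (le_lt_trans (F1 i))// ltry.
have FI i x : F i x -> I i (f x).
  move=> Fx; rewrite /I; case: pselect => [?|[]]; last by exists x.
  have lbF y z : F i y -> F i z -> f y - fine (diam (F i)) <= f z.
    move=> Fy Fz; rewrite lerBlDr -lerBlDl (le_trans (ler_norm _))//.
    by rewrite (le_trans (f1 _ _))// -lee_fin fineK// mdist_le_diam.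
  rewrite /= in_itv/=; apply/andP; split.
    apply: ge_inf; last by exists x.
    by exists (f x - fine (diam (F i))) => _ [y Fy <-]; exact: lbF.
  rewrite -lerBlDr; apply: lb_le_inf; first by exists (f x); exists x.
  by move=> _ [y Fy <-]; exact: lbF.
have mI i : measurable (I i).
  by rewrite /I; case: pselect => ?; [exact: measurable_itv|exact: measurable0].
have -> : r%:E = lebesgue_measure `[0, r[%classic.
  by rewrite lebesgue_measure_itv/= lte_fin r0 sube0.
apply: (@le_trans _ _ (\sum_(0 <= i <oo) lebesgue_measure (I i))%E).
  apply: measure_sigma_subadditive => // t; rewrite /= in_itv/= => /andP[t0 tr].
  have [x Ax <-] := fA _ t0 tr.
  by have [i _ Fx] := AF _ Ax; exists i => //; exact: FI.
apply: lee_nneseries => // i _; rewrite /I; case: pselect => ?.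
  rewrite lebesgue_measure_itv/=; case: ifPn => _; last exact: diam_ge0.
  by rewrite -EFinB addrAC subrr add0r fineK.
by rewrite measure0 diam_ge0.
Qed.

Lemma connected_image_interval A (f : X -> R) x y t :
  connected A -> continuous f -> A x -> A y -> f x <= t -> t <= f y ->
  exists2 z, A z & f z = t.
Proof.
move=> cA cf Ax Ay xt ty.
have /connected_intervalP : connected (f @` A).
  apply: connected_continuous_connected => //; exact: continuous_subspaceT.
move=> /(_ (f x) (f y)) h.
by have [z Az <-] := h (imageP _ Ax) (imageP _ Ay) t (introT andP (conj xt ty));
  exists z.
Qed.

(** By connectedness the distance to [c], which is 0 at [c] and at least [r] at [z], takes every
    value in [0, r[. *)
Lemma hausdorff1_ball_ge (c z : X) (r : R) : connected [set: X] -> r <= mdist c z ->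
  (r%:E <= hausdorff1 (ball c r))%E.
Proof.
move=> cX rz; apply: (@hausdorff1_lipschitz_ge _ (mdist c)).
  exact: mdist_dist.
move=> t t0 tr.
have [w _ wt] := @connected_image_interval setT (mdist c) c z t cX
   (@mdist_continuous c) I I (eq_ind_r (fun u => u <= t) t0 (mdistxx c))
   (ltW (lt_le_trans tr rz)).
by exists w => //; rewrite ballEmdist/= wt.
Qed.

Lemma hausdorff1_arc_ge (g : R -> X) (a b : R) : continuous g -> a <= b ->
  ((mdist (g a) (g b))%:E <= hausdorff1 (g @` `[a, b[))%E.
Proof.
move=> cg ab; apply: (@hausdorff1_lipschitz_ge _ (mdist (g a))).
  exact: mdist_dist.
move=> t t0 tr.
have ch : continuous (fun s => mdist (g a) (g s)).
  by move=> s; apply: continuous_comp; [exact: cg|exact: mdist_continuous].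
have [|s] := IVT ab (continuous_subspaceT ch) (v := t).
  by rewrite mdistxx ge_min le_max t0 (ltW tr) orbT.
rewrite in_itv/= => /andP[as_ sb] st; exists (g s) => //; exists s => //.
rewrite /= in_itv/= as_/= lt_neqAle sb andbT; apply/eqP => sb'.
by move: tr; rewrite -st sb' ltxx.
Qed.

End lower_bounds.

(** * Chains and their limit curves *)

Section chains.
Context {R : realType} {X : metricType R}.
Implicit Types (x y z : X) (s u : seq X) (w : X -> X -> R) (e t : R).

Fixpoint csum w x s : R := if s is y :: s' then w x y + csum w y s' else 0.

Definition mesh_le e : rel X := fun x y => mdist x y <= e.

Lemma csum_cat w x s u : csum w x (s ++ u) = csum w x s + csum w (last x s) u.
Proof. by elim: s x => [|y s IH] x /=; rewrite ?add0r// IH addrA. Qed.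

Lemma last_rev_belast x s : last (last x s) (rev (belast x s)) = x.
Proof. by case: s => //= y s; rewrite rev_cons last_rcons. Qed.

Lemma csum_rev w x s :
  csum w (last x s) (rev (belast x s)) = csum (fun y z => w z y) x s.
Proof.
elim: s x => [//|y s IH] x /=.
by rewrite rev_cons -cats1 csum_cat IH last_rev_belast /= addr0 addrC.
Qed.

Lemma csum_ge0 w x s : (forall y z, 0 <= w y z) -> 0 <= csum w x s.
Proof. by move=> w0; elim: s x => //= y s IH x; rewrite addr_ge0. Qed.

Lemma csumN w x s : csum (fun y z => - w y z) x s = - csum w x s.
Proof. by elim: s x => [|y s IH] x /=; rewrite ?oppr0// IH opprD. Qed.

Lemma csum_mdist_sym x s : csum (fun y z => mdist z y) x s = csum mdist x s.
Proof. by elim: s x => //= y s IH x; rewrite IH metric_sym. Qed.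

Lemma csum_mdist_ge0 x s : 0 <= csum mdist x s.
Proof. by apply: csum_ge0 => *; exact: mdist_ge0. Qed.

Lemma mdist_le_csum x s : mdist x (last x s) <= csum mdist x s.
Proof.
elim: s x => [|y s IH] x /=; first by rewrite mdistxx.
by apply: le_trans (metric_triangle x y _) _; rewrite lerD2l.
Qed.

(* Closed chains which, like a depth-first walk of a tree, cross every edge
   equally often in both directions. *)
Definition balanced x s := last x s = x /\
  forall w, (forall y z, w z y = - w y z) -> csum w x s = 0.

(** The inserted excursion follows [u] and returns, so its antisymmetric contributions cancel edge
    by edge. *)
Lemma balanced_insert x s1 s2 u (q := last x s1) : balanced x (s1 ++ s2) ->
  balanced x (s1 ++ (u ++ rev (belast q u)) ++ s2).
Proof.
rewrite /balanced !last_cat -/q => -[ls w0]; rewrite last_rev_belast.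
split=> // w wN; rewrite -(w0 w wN) !csum_cat -/q last_cat last_rev_belast.
rewrite csum_rev; congr (_ + _); rewrite -[RHS]add0r; congr (_ + _).
suff -> : csum (fun y z => w z y) q u = csum (fun y z => - w y z) q u.
  by rewrite csumN subrr.
by congr csum; apply/funext => y; apply/funext => z; rewrite wN.
Qed.

(** Twice the trapezoidal rule for the integral of f dg over one edge. Averaging the two ends makes
    it antisymmetric, hence of zero sum along balanced chains. *)
Definition trap (f g : X -> R) x y : R := (f x + f y) * (g y - g x).

Lemma trapN f g x y : trap f g y x = - trap f g x y.
Proof. by rewrite /trap addrC -mulrN opprB. Qed.

(** Collapsing a chain to its endpoints costs only the square of its length: prepending an edge of
    length d to a chain of length S adds products of an f-increment and a g-increment, at most 2 F G
    d S in all. *)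
Lemma csum_trap f g (F G : R) x s :
  (forall y z, `|f y - f z| <= F * mdist y z) ->
  (forall y z, `|g y - g z| <= G * mdist y z) -> 0 <= F -> 0 <= G ->
  `|csum (trap f g) x s - trap f g x (last x s)| <=
    2 * F * G * csum mdist x s ^+ 2.
Proof.
move=> fF gG F0 G0; elim: s x => [|y s IH] x /=.
  by rewrite /trap subrr mulr0 subr0 normr0 expr0n mulr0.
set z := last y s; set S := csum mdist y s.
have -> : trap f g x y + csum (trap f g) y s - trap f g x z =
  (f x - f y) * (g y - g z) + (f y - f z) * (g y - g x) +
  (csum (trap f g) y s - trap f g y z) by rewrite /trap; ring.
have S0 : 0 <= S := csum_mdist_ge0 y s.
have yz : mdist y z <= S := mdist_le_csum y s.
have d0 : 0 <= mdist x y := mdist_ge0 x y.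
have gxy : `|g y - g x| <= G * mdist x y by rewrite metric_sym.
have FS : F * mdist y z <= F * S by rewrite ler_wpM2l.
have GS : G * mdist y z <= G * S by rewrite ler_wpM2l.
have FG0 : 0 <= F * G by rewrite mulr_ge0.
have A1 : `|(f x - f y) * (g y - g z)| <= (F * mdist x y) * (G * S).
  by rewrite normrM ler_pM//; exact: le_trans (gG y z) GS.
have A2 : `|(f y - f z) * (g y - g x)| <= (F * S) * (G * mdist x y).
  by rewrite normrM ler_pM//; exact: le_trans (fF y z) FS.
have := IH y; rewrite -/z -/S => A3.
apply: le_trans (ler_normD _ _) _; apply: le_trans (lerD (ler_normD _ _) A3) _.
apply: le_trans (lerD (lerD A1 A2) (lexx _)) _.
set d := mdist x y in d0 *.
have := mulr_ge0 FG0 (mulr_ge0 d0 d0); have := mulr_ge0 FG0 (mulr_ge0 d0 S0).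
rewrite !exprS expr0; lra.
Qed.

(* Walking along the chain, staying [mdist y z + h] at [y] before jumping to
   the next point [z]: the part of the chain visited up to time [t]. *)
Fixpoint visited (h : R) x s t : seq X :=
  if s is y :: s' then
    if t < mdist x y + h then [::]
    else y :: visited h y s' (t - (mdist x y + h))
  else [::].

Lemma visited_le0 h x s t : 0 < h -> t <= 0 -> visited h x s t = [::].
Proof.
case: s => //= y s h0 t0; rewrite (le_lt_trans t0)//.
by rewrite ltr_wpDl// mdist_ge0.
Qed.

Lemma visited_all h x s t : 0 <= h -> csum mdist x s + h *+ size s <= t ->
  visited h x s t = s.
Proof.
move=> h0; elim: s x t => //= y s IH x t; rewrite mulrS => st.
have s0 := csum_mdist_ge0 y s; have hs : 0 <= h *+ size s by rewrite mulrn_wge0.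
by rewrite ltNge (_ : _ <= t) ?IH//=; lra.
Qed.

Lemma csum_visited h x s t : 0 <= h -> 0 <= t ->
  csum mdist x (visited h x s t) <= t.
Proof.
move=> h0; elim: s x t => //= y s IH x t t0; case: ltP => //= wt.
have := IH y (t - (mdist x y + h)); rewrite subr_ge0 => /(_ wt); lra.
Qed.

(** Time advances by length plus pauses, so the length gained is at most the elapsed time, up to one
    step begun earlier, which accounts for [e + h]. *)
Lemma visited_cat h e x s t t' : 0 <= h -> 0 <= e -> path (mesh_le e) x s ->
  t <= t' -> exists u, visited h x s t' = visited h x s t ++ u /\
    csum mdist (last x (visited h x s t)) u <= t' - t + (e + h).
Proof.
move=> h0 e0; elim: s x t t' => [|y s IH] x t t' /=.
  by move=> _ tt'; exists [::] => /=; split => //; lra.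
move=> /andP[xy ys] tt'; have [t'w|wt'] := ltP t' (mdist x y + h).
  by rewrite (le_lt_trans tt')//; exists [::] => /=; split => //; lra.
have [tw|wt] := ltP t (mdist x y + h).
  exists (y :: visited h y s (t' - (mdist x y + h))); split => //=.
  have := @csum_visited h y s (t' - (mdist x y + h)) h0.
  rewrite subr_ge0 => /(_ wt'); rewrite /mesh_le in xy; lra.
have [u [-> ul]] := IH y _ _ ys (lerB tt' (lexx (mdist x y + h))).
exists u; split => //=; move: ul; lra.
Qed.

(** The positive pause [h] gives every point of the chain a time of its own, even when it coincides
    with its predecessor. *)
Lemma visited_surj h x s z : 0 < h -> z \in x :: s -> exists t,
  [/\ 0 <= t, t <= csum mdist x s + h *+ size s & last x (visited h x s t) = z].
Proof.
move=> h0; elim: s x => [|y s IH] x.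
  by rewrite inE => /eqP ->; exists 0; rewrite mulr0n addr0.
rewrite inE => /orP[/eqP ->|/IH[t [t0 ts tz]]].
  exists 0; rewrite visited_le0//; split => //.
  by rewrite addr_ge0// ?csum_mdist_ge0// mulrn_wge0// ltW.
have d0 := mdist_ge0 x y; exists (t + (mdist x y + h)).
rewrite /= mulrS; split; [lra|lra|].
by rewrite ltNge (_ : _ <= _) ?addrK//=; lra.
Qed.

End chains.

(** * Pointwise limits of chains *)

Section limit_curves.
Context {R : realType} {X : metricType R}.
Hypothesis cX : compact [set: X].
Implicit Types (x y z : X) (s u : seq X) (t : R).

(** Along an ultrafilter finer than the cofinite one, [f n t] converges for all [t] at once by
    compactness. What is kept is approximation at any finite set of times by some arbitrarily late
    [n]. *)
Lemma cluster_curve (f : nat -> R -> X) : exists g : R -> X,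
  forall (ts : seq R) (e : R) (N : nat), 0 < e -> exists2 n, (N <= n)%N &
    forall t, t \in ts -> mdist (f n t) (g t) < e.
Proof.
have [U [UU NU]] := @ultraFilterLemma nat \oo _.
have lim t : exists p, forall e : R, 0 < e -> U [set n | mdist (f n t) p < e].
  pose F := (f ^~ t) @ U.
  have FF : ProperFilter F by exact: fmap_proper_filter.
  have [p [_ pF]] := cX FF (filterT : F setT).
  exists p => e e0; have [//|UC] := in_ultra_setVsetC [set n | mdist (f n t) p < e] UU.
  have [y [/= ny]] : [set y | ~ (mdist y p < e)] `&` ball p e !=set0.
    by apply: pF; [exact: UC|exact: nbhsx_ballx].
  by rewrite ballEmdist/= metric_sym.
have [g gU] := choice lim; exists g => ts e N e0.
suff : U [set n | (N <= n)%N /\ forall t, t \in ts -> mdist (f n t) (g t) < e].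
  by move=> /filter_ex[n [Nn h]]; exists n.
apply: filterI; first by apply: NU; exists N.
elim: ts => [|t ts IH]; first by apply: filterS filterT => n _ t.
apply: filterS (filterI (gU t e e0) IH) => n [/= nt nts] t'.
by rewrite inE => /orP[/eqP ->//|/nts].
Qed.

(** The [f n] jump from point to point, so they are Lipschitz only up to an additive error; it
    vanishes in the limit. *)
Lemma cluster_curve_lipschitz (f : nat -> R -> X) (g : R -> X) (L : R) :
  (forall (ts : seq R) (e : R) (N : nat), 0 < e -> exists2 n, (N <= n)%N &
    forall t, t \in ts -> mdist (f n t) (g t) < e) ->
  (forall n t t', t <= t' -> mdist (f n t) (f n t') <=
    (L + 2 * n.+1%:R^-1) * (t' - t) + 2 * n.+1%:R^-1) ->
  forall t t', mdist (g t) (g t') <= L * `|t' - t|.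
Proof.
move=> fg fL; suff le t t' : t <= t' -> mdist (g t) (g t') <= L * (t' - t).
  move=> t t'; case: (leP t t') => [tt'|/ltW t't].
    by rewrite ger0_norm ?subr_ge0//; exact: le.
  by rewrite distrC metric_sym ger0_norm ?subr_ge0//; exact: le.
move=> tt'; apply/ler_addgt0Pr => e e0.
(* Total of the error coefficients: 2(t' - t) from the slope, 2 from the jumps, and 1 for each of
   the two approximated endpoints. *)
pose c := 2 * (t' - t) + 4.
have c0 : 0 < c by rewrite /c; have : 0 <= t' - t by [lra|]; lra.
have [N Nc] := @ltr_add_invr R 0 (e / c) (divr_gt0 e0 c0).
have [n Nn fgn] := fg [:: t; t'] (N.+1%:R^-1) N (ltac:(by rewrite invr_gt0)).
have a0 : n.+1%:R^-1 <= N.+1%:R^-1 :> R by rewrite lef_pV2 ?posrE// ler_nat.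
have := fgn t (mem_head _ _); have := fgn t'; rewrite !inE eqxx orbT => /(_ isT).
have := fL n _ _ tt'.
have := metric_triangle (g t) (f n t) (g t').
have := metric_triangle (f n t) (f n t') (g t').
rewrite (metric_sym (g t) (f n t)) => h1 h2 h3 h4 h5.
have : N.+1%:R^-1 * c < e by rewrite -ltr_pdivlMr// -[ltLHS]add0r.
have : n.+1%:R^-1 * (t' - t) <= N.+1%:R^-1 * (t' - t).
  by rewrite ler_wpM2r// subr_ge0.
move: h1 h2 h3 h4 h5 a0; rewrite /c.
move: (N.+1%:R^-1) (n.+1%:R^-1) => a b.
move=> h1 h2 h3 h4 h5 a0 h6 h7; move: h3; rewrite mulrDl. lra.
Qed.

End limit_curves.

Section chain_curves.
Context {R : realType} {X : metricType R}.
Implicit Types (x y z : X) (s u : seq X) (t : R).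

Lemma chain_curve x s (e L : R) : 0 < e -> path (mesh_le e) x s ->
  csum mdist x s <= L ->
  exists c : R -> seq X,
  [/\ c 0 = [::], c 1 = s,
      (forall t t', t <= t' -> exists u, c t' = c t ++ u /\
         csum mdist (last x (c t)) u <= (L + e) * (t' - t) + 2 * e),
      (forall t, t <= 0 -> c t = [::]) /\ (forall t, 1 <= t -> c t = s) &
      forall z, z \in x :: s -> exists2 t, t \in `[0, 1] & last x (c t) = z].
Proof.
(* The pauses last at most [e] altogether, so running the clock at rate [L + e] finishes the chain
   by time 1. *)
move=> e0 xs sL; pose h := e / (size s).+1%:R.
have h0 : 0 < h by rewrite divr_gt0.
have L0 : 0 <= L := le_trans (csum_mdist_ge0 x s) sL.
have Le : 0 < L + e by lra.
have he : h <= e by rewrite ler_pdivrMr// ler_peMr ?ler1n// ltW.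
have hs : csum mdist x s + h *+ size s <= L + e.
  apply: lerD => //; rewrite -mulr_natr mulrAC ler_pdivrMr//.
  by apply: ler_wpM2l; [exact: ltW|rewrite ler_nat].
exists (fun t => visited h x s ((L + e) * t)).
have c0 t : t <= 0 -> visited h x s ((L + e) * t) = [::].
  by move=> t0; apply: visited_le0 => //; rewrite pmulr_rle0.
have c1 t : 1 <= t -> visited h x s ((L + e) * t) = s.
  move=> t1; apply: visited_all; [exact: ltW|apply: le_trans hs _].
  by rewrite ler_peMr// ltW.
split => //.
- exact: c0.
- exact: c1.
- move=> t t' tt'.
  have [u [-> ul]] := visited_cat (ltW h0) (ltW e0) xs (ler_wpM2l (ltW Le) tt').
  by exists u; split => //; move: ul; rewrite mulrBr; lra.
- move=> z /(visited_surj h0)[t [t0 ts tz]]; exists (t / (L + e)).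
    rewrite in_itv/= divr_ge0//= ?(ltW Le)// ler_pdivrMr// mul1r.
    exact: le_trans hs.
  by rewrite mulrC divfK// gt_eqF.
Qed.

Lemma csum_mkseq (w : X -> X -> R) (c : nat -> X) n :
  csum w (c 0%N) (mkseq (fun i => c i.+1) n) = \sum_(i < n) w (c i) (c i.+1).
Proof.
elim: n c => [|n IH] c; first by rewrite big_ord0.
rewrite big_ord_recl/= -(IH (fun i => c i.+1)); congr (_ + csum _ _ _).
by rewrite /mkseq -[1%N]addn0 iotaDl -map_comp.
Qed.

Lemma path_mkseq (r : rel X) (c : nat -> X) n :
  (forall i, (i < n)%N -> r (c i) (c i.+1)) ->
  path r (c 0%N) (mkseq (fun i => c i.+1) n).
Proof.
move=> rc; apply/(pathP (c 0%N)) => i; rewrite size_mkseq => ni.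
rewrite nth_mkseq//; case: i ni => [|i] ni; first exact: rc.
by rewrite /= nth_mkseq ?(ltnW ni)//; exact: rc.
Qed.

Lemma last_mkseq (c : nat -> X) n : last (c 0%N) (mkseq (fun i => c i.+1) n) = c n.
Proof. by case: n => // n; rewrite mkseqS last_rcons. Qed.

Lemma lipschitz_chain (g : R -> X) (a b L e : R) : a <= b -> 0 < e ->
  (forall t t', mdist (g t) (g t') <= L * `|t' - t|) ->
  exists s, [/\ path (mesh_le e) (g a) s, last (g a) s = g b,
    csum mdist (g a) s <= L * (b - a),
    (forall z, z \in s -> exists2 t, t \in `[a, b] & z = g t) &
    forall t, t \in `[a, b] -> exists2 z, z \in g a :: s & mdist (g t) z <= e].
Proof.
move=> ab e0 gL.
pose K := (Num.truncn (`|L| * (b - a) / e)).+1.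
have K0 : 0 < K%:R :> R by rewrite ltr0n.
have KL : `|L| * ((b - a) / K%:R) <= e.
  rewrite mulrA ler_pdivrMr// [e * _]mulrC -ler_pdivrMr//.
  exact/ltW/truncnS_gt.
pose p (i : nat) := a + (b - a) * (i%:R / K%:R).
have pS i : p i.+1 - p i = (b - a) / K%:R.
  by rewrite /p -natr1; field; rewrite gt_eqF.
have pab i : (i <= K)%N -> p i \in `[a, b].
  move=> iK; have iK1 : i%:R / K%:R <= 1 :> R by rewrite ler_pdivrMr// mul1r ler_nat.
  have iK0 : 0 <= i%:R / K%:R :> R by rewrite divr_ge0.
  rewrite in_itv/= /p; apply/andP; split; nra.
pose c i := g (p i).
have c0 : g a = c 0%N by rewrite /c /p mul0r mulr0 addr0.
have cK : g b = c K by rewrite /c /p divff ?gt_eqF// mulr1 addrC subrK.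
have ba0 : 0 <= (b - a) / K%:R by rewrite divr_ge0 ?(ltW K0)// subr_ge0.
have cS i : mdist (c i) (c i.+1) <= L * ((b - a) / K%:R).
  by apply: le_trans (gL _ _) _; rewrite pS ger0_norm.
exists (mkseq (fun i => c i.+1) K); rewrite c0 cK.
split.
- apply: path_mkseq => i _; apply: le_trans (cS i) _; apply: le_trans KL.
  by rewrite ler_wpM2r// ler_norm.
- exact: last_mkseq.
- rewrite csum_mkseq; apply: le_trans (ler_sum _ (fun (i : 'I_K) _ => cS i)) _.
  rewrite sumr_const card_ord -[leLHS]mulr_natr -mulrA divfK ?gt_eqF//.
- move=> z /mapP[i]; rewrite mem_iota => /andP[_ iK] ->.
  by exists (p i.+1) => //; exact: pab.
- move=> t; rewrite in_itv/= => /andP[at_ tb].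
  suff [i iK /andP[pt tp]] : exists2 i, (i < K)%N & p i <= t <= p i.+1.
    exists (c i).
      case: i iK pt tp => [|i] iK _ _; first exact: mem_head.
      rewrite inE; apply/orP; right; apply/mapP; exists i => //.
      by rewrite mem_iota (ltnW iK).
    rewrite metric_sym; apply: le_trans (gL _ _) _; apply: le_trans KL.
    rewrite ger0_norm ?subr_ge0//.
    apply: (@le_trans _ _ (`|L| * (t - p i))).
      by rewrite ler_wpM2r ?subr_ge0// ler_norm.
    by apply: ler_wpM2l => //; have := pS i; lra.
  have : t <= p K by rewrite /p divff ?gt_eqF//; lra.
  rewrite /K; elim: (Num.truncn _) => [|k IH] tk.
    by exists 0%N => //; rewrite tk {1}/p mul0r mulr0 addr0 at_.
  have [/IH[i ik ti]|/ltW kt] := leP t (p k.+1); first by exists i => //; exact: ltnW.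
  by exists k.+1 => //; rewrite kt tk.
Qed.

End chain_curves.

(** * Shortest arcs *)

Section short_chains.
Context {R : realType} {X : metricType R}.
Implicit Types (x y z : X) (s u : seq X) (t e : R) (c : nat -> X) (N : nat).

Definition steps e y z N := exists c, [/\ c 0%N = y, c N = z &
  forall i, (i < N)%N -> mdist (c i) (c i.+1) <= e].

Lemma steps_rcons e y z z' N : steps e y z N -> mdist z z' <= e ->
  steps e y z' N.+1.
Proof.
move=> [c [c0 cN cS]] zz'; exists (fun k => if (k <= N)%N then c k else z').
split=> [//||i iN]; first by rewrite ltnn.
rewrite -ltnS iN; case: ltnP => [{}iN|Ni]; first exact: cS.
by rewrite (_ : i = N) ?cN//; lia.
Qed.

(** The set of points reachable by steps of size [e] is open, and so is its complement. *)
Lemma connected_steps e y z : connected [set: X] -> 0 < e ->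
  exists N, steps e y z N.
Proof.
move=> cX e0; pose B := [set z | exists N, steps e y z N].
have Bball w w' : B w -> mdist w w' <= e -> B w'.
  by move=> [N wN] ww'; exists N.+1; exact: steps_rcons ww'.
have BT : B = setT.
  apply: cX.
  - by exists y; exists 0%N; exists (fun=> y).
  - exists B; last by rewrite setTI.
    rewrite openE => w Bw; apply/nbhs_ballP; exists e => //= w'.
    by rewrite ballEmdist/= => /ltW; exact: Bball.
  - exists B; last by rewrite setTI.
    rewrite -openC openE => w Bw; apply/nbhs_ballP; exists e => //= w'.
    rewrite ballEmdist/= => /ltW ww' Bw'; apply: Bw; apply: Bball Bw' _.
    by rewrite metric_sym.
by have : B z by rewrite BT.
Qed.

Lemma steps_shortcut e y z N i j c : c 0%N = y -> c N = z ->
  (forall k, (k < N)%N -> mdist (c k) (c k.+1) <= e) ->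
  (i < j)%N -> (j <= N)%N -> mdist (c i) (c j) <= e ->
  steps e y z (N - (j - i.+1))%N.
Proof.
move=> c0 cN cS ij jN cij.
exists (fun k => if (k <= i)%N then c k else c (k + (j - i.+1))%N).
split=> [//||k kN].
- by rewrite leqNgt (_ : (i < _)%N) ?subnK//; lia.
- have [ik|ik|ik] := ltngtP k i.
  + by apply: cS; lia.
  + by rewrite addSn; apply: cS; lia.
  + by rewrite ik subnKC.
Qed.

(** Centres more than [3 * r] apart leave a gap [r] between the balls, so [hausdorff1_separated]
    adds their measures one at a time. *)
Lemma hausdorff1_disjoint_balls (r : R) (I : nat -> X) n : 0 < r ->
  (forall i j, (i < j)%N -> (j < n)%N -> 3 * r < mdist (I i) (I j)) ->
  (forall i, (i < n)%N -> (r%:E <= hausdorff1 (ball (I i) r))%E) ->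
  (\sum_(i < n) r%:E <= hausdorff1 [set: X])%E.
Proof.
move=> r0 sep ballr.
suff H k : (k <= n)%N -> (\sum_(i < k) r%:E <=
    hausdorff1 [set x | exists2 i, (i < k)%N & ball (I i) r x])%E.
  by apply: le_trans (H n (leqnn n)) _; exact: le_hausdorff1.
elim: k => [|k IH] kn; first by rewrite big_ord0 hausdorff1_ge0.
rewrite big_ord_recr/=.
apply: le_trans (leeD (IH (ltnW kn)) (ballr _ kn)) _.
apply: (@le_trans _ _ (hausdorff1 ([set x | exists2 i, (i < k)%N & ball (I i) r x]
    `|` ball (I k) r))).
  apply: (hausdorff1_separated r0) => x x' [i ik]; rewrite !ballEmdist/= => ix kx'.
  have := sep _ _ ik kn; have := metric_triangle (I i) x (I k).
  have := metric_triangle x x' (I k); rewrite (metric_sym x'); lra.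
apply: le_hausdorff1 => x [[i ik ix]|kx]; last by exists k.
by exists i => //; exact: ltnW.
Qed.

(* A shortest chain has no shortcuts, so the balls of radius e/4 around every
   other of its points are disjoint, and each has measure at least e/4. *)
Lemma short_chain e y z : connected [set: X] ->
  (hausdorff1 [set: X] < +oo)%E -> 0 < e ->
  exists s, [/\ path (mesh_le e) y s, last y s = z &
    csum mdist y s <= 8 * fine (hausdorff1 [set: X]) + e].
Proof.
move=> cX Hfin e0; set H := fine _.
have H0 : 0 <= H by rewrite fine_ge0// hausdorff1_ge0.
have [yz|yz] := leP (mdist y z) e.
  exists [:: z]; split => //=; first by rewrite /mesh_le yz.
  by rewrite addr0 (le_trans yz)// lerDr mulr_ge0.
have [N0 yN0] := connected_steps y z cX e0.
have : exists N, `[< steps e y z N >] by exists N0; apply/asboolP.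
move=> /ex_minnP[N /asboolP[c [c0 cN cS]] minN].
exists (mkseq (fun i => c i.+1) N); rewrite -{1 2 3}c0; split.
- exact: path_mkseq.
- by rewrite last_mkseq.
have far i j : (i.+1 < j)%N -> (j <= N)%N -> e < mdist (c i) (c j).
  move=> ij jN; rewrite ltNge; apply/negP => cij.
  have /asboolP/minN := steps_shortcut c0 cN cS (ltnW ij) jN cij.
  by lia.
(* Since [y] and [z] are more than [e] apart, one of them is at distance at least e/4 from [c k], as
   [hausdorff1_ball_ge] requires. *)
have balls k : (((e / 4)%:E) <= hausdorff1 (ball (c k) (e / 4)))%E.
  have [cy|cy] := leP (e / 4) (mdist (c k) y); first exact: hausdorff1_ball_ge cy.
  apply: (hausdorff1_ball_ge (z := z)) => //.
  have := metric_triangle y (c k) z; rewrite (metric_sym y (c k)); lra.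
have e4 : 0 < e / 4 by lra.
(* Distinct even indices differ by at least 2, so [far] puts the centres more than e > 3(e/4) apart.
   With m = [N./2.+1] balls this gives m e/4 <= H, and the chain has length at most N e <= 2 m e <=
   8 H. *)
have := @hausdorff1_disjoint_balls (e / 4) (fun i => c i.*2) N./2.+1 e4 _ _.
rewrite sumEFin sumr_const card_ord -(fineK (x := hausdorff1 setT)); last first.
  by rewrite ge0_fin_numE// hausdorff1_ge0.
rewrite lee_fin -/H => h.
have {}h : (e / 4) *+ N./2.+1 <= H.
  apply: h => // i j ij jN; apply: le_lt_trans (far _ _ _ _); [lra|lia|lia].
rewrite csum_mkseq.
have cSo (i : 'I_N) : true -> mdist (c i) (c i.+1) <= e by move=> _; exact: cS.
apply: le_trans (ler_sum _ cSo) _; rewrite sumr_const card_ord.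
apply: (@le_trans _ _ (e *+ (N./2.+1).*2)); first by apply: ler_wpMn2l; [exact: ltW|lia].
rewrite -muln2 mulrnA; move: h; rewrite -[e / 4 *+ _]mulr_natr -[e *+ _ *+ _]mulr_natr.
by rewrite -[e *+ _]mulr_natr; move: (N./2.+1%:R : R) => M h; lra.
Qed.

End short_chains.

(** * Measure of injective arcs *)

Section arc_images.
Context {R : realType} {X : metricType R}.

(** A half-open arc is a countable union of compact ones. Half-open arcs are the right pieces
    because consecutive ones do not share an endpoint. *)
Lemma caratheodory_arc (g : R -> X) (a b : R) : continuous g ->
  caratheodory_measurable (@hausdorff1 R X) (g @` `[a, b[).
Proof.
move=> cg.
have -> : g @` `[a, b[ = \bigcup_n g @` `[a, b - n.+1%:R^-1].
  apply/seteqP; split=> [x [t]|x [n _ [t]]]; rewrite /= in_itv/= => /andP[ta tb].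
    move=> <-; have [n tn] := ltr_add_invr tb; exists n => //; exists t => //=.
    by rewrite in_itv/= ta/= lerBrDr ltW.
  move=> <-; exists t => //=; rewrite in_itv/= ta/= (le_lt_trans tb)//.
  by rewrite ltrBlDr ltrDl.
apply: caratheodory_measurable_bigcup => n; apply: closed_caratheodory.
apply: compact_closed; first exact: metric_hausdorff.
apply: continuous_compact; last exact: segment_compact.
exact: continuous_subspaceT.
Qed.

(** Injectivity makes the measurable subarcs disjoint, so their measures add up, and each is at
    least its chord. *)
Lemma hausdorff1_injective_arc (g : R -> X) (p : nat -> R) n : continuous g ->
  (forall i, (i < n)%N -> p i <= p i.+1) ->
  {in `[p 0%N, p n] &, injective g} ->
  ((\sum_(i < n) mdist (g (p i)) (g (p i.+1)))%:E <=
    hausdorff1 (g @` `[p 0%N, p n[))%E.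
Proof.
move=> cg pS gI.
have mono i j : (i <= j)%N -> (j <= n)%N -> p i <= p j.
  move=> /subnKC <-; elim: (j - i)%N => [|k IH] kn; first by rewrite addn0.
  by rewrite addnS; apply: le_trans (IH _) (pS _ _); lia.
pose A i := if (i < n)%N then g @` `[p i, p i.+1[ else set0.
have mA i : caratheodory_measurable (@hausdorff1 R X) (A i).
  rewrite /A; case: ifP => _; first exact: caratheodory_arc.
  exact: caratheodory_measurable_set0.
have tA : trivIset setT A.
  have disj i j x : (i < j)%N -> A i x -> A j x -> False.
    move=> ij; rewrite /A; case: ifP => // iN; case: ifP => // jN.
    move=> [s]; rewrite /= in_itv/= => /andP[is_ si] <-.
    move=> [t]; rewrite /= in_itv/= => /andP[jt tj] ts.
    have h1 := mono _ _ (leq0n i) (ltnW iN); have h2 := mono _ _ (leq0n j) (ltnW jN).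
    have h3 := mono _ _ iN (leqnn n); have h4 := mono _ _ jN (leqnn n).
    have h5 := mono _ _ ij (ltnW jN).
    have := gI t s; rewrite !in_itv/= => /(_ _ _ ts) tse.
    by have : t = s by [apply: tse; apply/andP; split; lra]; lra.
  move=> i j _ _ [x [Ai Aj]]; have [ij|ji|//] := ltngtP i j.
    by have := disj _ _ _ ij Ai Aj.
  by have := disj _ _ _ ji Aj Ai.
rewrite -sumEFin.
apply: (@le_trans _ _ (\sum_(i < n) hausdorff1 (setT `&` A i))%E).
  apply: lee_sum => i _; rewrite setTI /A ltn_ord.
  by apply: hausdorff1_arc_ge => //; exact: pS.
rewrite -caratheodory_additive// setTI; apply: le_hausdorff1.
rewrite -(bigcup_mkord n A) => x [i /= iN]; rewrite /A iN => -[t].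
rewrite /= in_itv/= => /andP[it ti] <-; exists t => //=.
rewrite in_itv/= (le_trans _ it) ?(lt_le_trans ti)//; apply: mono => //.
exact: ltnW.
Qed.

End arc_images.

Section shortest_arc.
Context {R : realType} {X : metricType R}.
Hypothesis cX : compact [set: X].
Hypothesis conX : connected [set: X].
Hypothesis Hfin : (hausdorff1 [set: X] < +oo)%E.

Let chain_length (T : set X) (y : X) (e : R) : set R :=
  [set l | exists s, [/\ path (mesh_le e) y s, T (last y s) & l = csum mdist y s]].

(* The length l is the supremum over e of the infimal length of the chains of
   mesh e from y to T, hence no curve from y to T can be shorter. *)
Lemma shortest_arc (T : set X) (y z : X) : closed T -> T z -> ~ T y ->
  exists (g : R -> X) (l : R),
  [/\ forall t t', mdist (g t) (g t') <= l * `|t' - t|,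
      g 0 = y /\ T (g 1),
      (forall t, 0 <= t -> t < 1 -> ~ T (g t)) &
      (l%:E <= hausdorff1 (g @` `[0%R, 1%R[))%E].
Proof.
move=> cT Tz nTy; pose S := chain_length T y; pose H := fine (hausdorff1 [set: X]).
have S0 e : lbound (S e) 0 by move=> _ [s [_ _ ->]]; exact: csum_mdist_ge0.
(* The bound from [short_chain] stays bounded as [e] shrinks; this keeps the supremum [l] of the
   infima finite. *)
have SH e : 0 < e -> exists2 l, S e l & l <= 8 * H + e.
  move=> e0; have [s [ys sz sl]] := short_chain y z conX Hfin e0.
  by exists (csum mdist y s) => //; exists s; rewrite sz.
have Sinf e : 0 < e -> has_inf (S e).
  by move=> e0; split; [have [l] := SH e e0; exists l|exists 0; exact: S0].
pose E := [set inf (S e) | e in [set e | 0 < e <= 1]].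
have supE : has_sup E.
  split; first by exists (inf (S 1)); exists 1 => //=; rewrite ltr01 lexx.
  exists (8 * H + 1) => _ [e /andP[e0 e1] <-].
  have [l Sl lH] := SH e e0.
  by rewrite (le_trans (ge_inf (Sinf e e0).2 Sl))// (le_trans lH)// lerD2l.
pose l := sup E.
have lE e : 0 < e -> e <= 1 -> inf (S e) <= l.
  by move=> e0 e1; apply: sup_upper_bound => //; exists e => //=; rewrite e0.
(* The form in which minimality is used: chains from [y] to [T] of every small mesh and of length at
   most [L] force l <= L. *)
have l_le L : (forall e, 0 < e -> e <= 1 -> exists2 l', S e l' & l' <= L) -> l <= L.
  move=> h; apply: ge_sup; first exact: supE.1.
  move=> _ [e /andP[e0 e1] <-]; have [l' Sl' l'L] := h e e0 e1.
  by apply: le_trans l'L; apply: ge_inf => //; exact: (Sinf e e0).2.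
have /choice[s sP] (n : nat) : exists s, [/\ path (mesh_le n.+1%:R^-1) y s,
    T (last y s) & csum mdist y s <= l + n.+1%:R^-1].
  have e0 : 0 < n.+1%:R^-1 :> R by rewrite invr_gt0.
  have [_ [s [ys sT ->]] sl] := inf_adherent e0 (Sinf _ e0).
  exists s; split => //; apply/ltW/(lt_le_trans sl).
  by rewrite lerD2r lE// invf_le1// ler1n.
have /choice[c cP] (n : nat) := chain_curve (ltac:(by rewrite invr_gt0) :
  0 < n.+1%:R^-1 :> R) (let: And3 a _ _ := sP n in a) (let: And3 _ _ a := sP n in a).
pose f n t := last y (c n t).
have [g fg] := cluster_curve cX f.
have gl : forall t t', mdist (g t) (g t') <= l * `|t' - t|.
  apply: (cluster_curve_lipschitz fg) => n t t' tt'.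
  have [_ _ /(_ _ _ tt')[u [cu ul]] _ _] := cP n.
  rewrite /f cu last_cat (le_trans (mdist_le_csum _ _))// (le_trans ul)//.
  rewrite lerD2r ler_wpM2r ?subr_ge0//; move: (n.+1%:R^-1) => a; lra.
have g0 : g 0 = y.
  apply: mdist_positivity; apply/eqP; rewrite eq_le mdist_ge0 andbT.
  apply/ler_addgt0Pr => e e0; have [n _ /(_ 0 (mem_head _ _))] := fg [:: 0] e 0%N e0.
  by rewrite /f; have [-> _ _ _ _] := cP n; rewrite /= metric_sym add0r => /ltW.
have gT : T (g 1).
  apply: cT => B /nbhs_ballP[e /= e0 eB].
  have [n _ /(_ 1 (mem_head _ _)) h] := fg [:: 1] e 0%N e0.
  exists (f n 1); split.
    by rewrite /f; have [_ -> _ _ _] := cP n; have [] := sP n.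
  by apply: eB; rewrite ballEmdist/= metric_sym.
have l0 : 0 < l.
  have : 0 < mdist (g 0) (g 1).
    by rewrite mdist_gt0; apply/eqP => g01; apply: nTy; rewrite -g0 g01.
  by move=> h; have := lt_le_trans h (gl 0 1); rewrite subr0 normr1 mulr1.
(* If [g] met [T] at a time t < 1, sampling it up to [t] would give chains of length at most l t <
   l. *)
have gnT t : 0 <= t -> t < 1 -> ~ T (g t).
  move=> t0 t1 Tt; suff : l <= l * t by rewrite ler_pMr// leNgt t1.
  apply: l_le => e e0 e1.
  have [s' [s'p s'l s'c _ _]] := lipschitz_chain t0 e0 gl.
  exists (csum mdist (g 0) s'); last by rewrite subr0 in s'c.
  by exists s'; rewrite -g0 s'l.
(* If g t = g t', skipping the loop between these times gives chains of length at most l(1 - (t' -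
   t)) < l. *)
have gI : {in `[0, 1] &, injective g}.
  have lt t t' : 0 <= t -> t < t' -> t' <= 1 -> g t != g t'.
    move=> t0 tt' t1; apply/eqP => gtt'; suff : l <= l * (1 - (t' - t)).
      by rewrite ler_pMr//; lra.
    apply: l_le => e e0 e1.
    have [s1 [s1p s1l s1c _ _]] := lipschitz_chain t0 e0 gl.
    have [s2 [s2p s2l s2c _ _]] := lipschitz_chain t1 e0 gl.
    exists (csum mdist y (s1 ++ s2)).
      exists (s1 ++ s2); rewrite cat_path last_cat -g0 s1l gtt' s2l; split => //.
      by rewrite s1p.
    rewrite csum_cat -g0 s1l gtt'; lra.
  move=> t t'; rewrite !in_itv/= => /andP[t0 t1] /andP[t'0 t'1] gtt'.
  have [tt'|t't|//] := ltgtP t t'.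
  - by have := lt _ _ t0 tt' t'1; rewrite gtt' eqxx.
  - by have := lt _ _ t'0 t't t1; rewrite gtt' eqxx.
exists g, l; split => //.
have Hg : hausdorff1 (g @` `[0, 1[) \is a fin_num.
  rewrite ge0_fin_numE ?hausdorff1_ge0//.
  by apply: le_lt_trans Hfin; exact: le_hausdorff1.
(* A fine sampling of [g] is itself a chain from [y] to [T], and injectivity bounds its length by
   the measure of the arc. *)
rewrite -(fineK Hg) lee_fin; apply: l_le => e e0 e1.
pose K := (Num.truncn (l / e)).+1.
have K0 : 0 < K%:R :> R by rewrite ltr0n.
pose p (i : nat) : R := i%:R / K%:R.
have p0 : p 0%N = 0 by rewrite /p mul0r.
have pK : p K = 1 by rewrite /p divff// gt_eqF.
have pS i : p i.+1 - p i = K%:R^-1 by rewrite /p -mulrBl -natr1 addrAC subrr add0r mul1r.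
have cg : continuous g := lipschitz_curve_continuous gl.
exists (\sum_(i < K) mdist (g (p i)) (g (p i.+1))).
  exists (mkseq (fun i => g (p i.+1)) K); have -> : y = g (p 0%N) by rewrite p0.
  rewrite (last_mkseq (fun i => g (p i))) pK (csum_mkseq _ (fun i => g (p i))).
  split => //; apply: (path_mkseq (c := fun i => g (p i))) => i iK.
  apply: le_trans (gl _ _) _; rewrite pS ger0_norm ?invr_ge0//.
  rewrite ler_pdivrMr// mulrC -ler_pdivrMr//; exact/ltW/truncnS_gt.
rewrite -lee_fin fineK//.
have := @hausdorff1_injective_arc _ _ g p K cg; rewrite p0 pK; apply => //.
by move=> i _; rewrite -subr_ge0 pS invr_ge0.
Qed.

End shortest_arc.

(** Compactness is applied to the filter of finite sequences directed by inclusion: near [z] it is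
    enough that the sequence contains [z]. *)
Lemma compact_finite_net (R : realType) (X : metricType R) (e : R) :
  compact [set: X] -> 0 < e ->
  exists ys : seq X, forall z, exists2 y, y \in ys & mdist z y < e.
Proof.
move=> cX e0.
pose F : set_system (seq X) :=
  filter_from setT (fun s : seq X => [set s' : seq X | {subset s <= s'}]).
have FF : Filter F.
  apply: filter_from_filter; first by exists [::].
  move=> s1 s2 _ _; exists (s1 ++ s2) => // s sub.
  by split=> a as_; apply: sub; rewrite mem_cat as_ ?orbT.
have /compact_near_coveringP := cX.
move=> /(_ _ F (fun s z => exists2 y, y \in s & mdist z y < e) FF) [].
  move=> z _; exists (ball z (e), [set s : seq X | {subset [:: z] <= s}]).
    by split; [exact: nbhsx_ballx|exists [:: z]].
  move=> [z' s] [/=]; rewrite ballEmdist/= metric_sym => zz' zs.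
  by exists z => //; apply: zs; exact: mem_head.
by move=> s _ sub; exists s => z; apply: (sub s).
Qed.

(** * The limit loop *)

Section loops.
Context {R : realType} {X : metricType R}.
Hypothesis cX : compact [set: X].
Hypothesis conX : connected [set: X].
Hypothesis Hfin : (hausdorff1 [set: X] < +oo)%E.
Implicit Types (x y z p : X) (s u : seq X) (e : R) (T : set X).

(** Invariant of the induction: [T] can be traced by walks costing twice its measure. It is demanded
    at every scale, so that attaching an arc can call it at scale e/4 and answer at scale [e]. *)
Definition walkable T := forall e, 0 < e -> exists x s,
  [/\ balanced x s, path (mesh_le e) x s, (forall z, z \in x :: s -> T z),
     (forall z, T z -> exists2 p, p \in x :: s & mdist z p <= e) &
     csum mdist x s <= 2 * fine (hausdorff1 T) + e].

Lemma path_mesh_rev e x s :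
  path (mesh_le e) (last x s) (rev (belast x s)) = path (mesh_le e) x s.
Proof.
rewrite rev_path; apply: eq_path => y z; rewrite /mesh_le; congr (_ <= _).
exact: metric_sym.
Qed.

Lemma fin_num_hausdorff1 T : hausdorff1 T \is a fin_num.
Proof.
rewrite ge0_fin_numE ?hausdorff1_ge0//.
by apply: le_lt_trans Hfin; exact: le_hausdorff1.
Qed.

(** A shortest arc from [y] to [T] is attached. The walk makes a detour along it and back, costing
    about twice its length, while the measure grows by at least that length. *)
Lemma walkable_add T y z : closed T -> T z -> walkable T ->
  exists T', [/\ closed T', T `<=` T', T' y & walkable T'].
Proof.
move=> cT Tz wT; have [Ty|nTy] := pselect (T y); first by exists T; split.
have [g [l [gl [g0 gT] gnT lH]]] := shortest_arc cX conX Hfin cT Tz nTy.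
have cg : continuous g := lipschitz_curve_continuous gl.
pose T' := T `|` g @` `[0, 1].
have cT' : closed T'.
  apply: closedU => //; apply: compact_closed; first exact: metric_hausdorff.
  apply: continuous_compact; last exact: segment_compact.
  exact: continuous_subspaceT.
(* The arc without its end is disjoint from [T], and the closed set [T] splits the measure of
   [T']. *)
have HT' : fine (hausdorff1 T) + l <= fine (hausdorff1 T').
  rewrite -lee_fin EFinD !fineK ?fin_num_hausdorff1//.
  rewrite [leRHS](closed_caratheodory cT) leeD//.
    by apply: le_hausdorff1 => x Tx; split => //; left.
  apply: le_trans lH _; apply: le_hausdorff1 => ? [t + <-].
  rewrite /= in_itv/= => /andP[t0 t1]; split; last exact: gnT.
  by right; exists t => //=; rewrite in_itv/= t0 ltW.
exists T'; split => //; first by left.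
  by right; exists 0 => //; rewrite /= in_itv/= lexx ler01.
move=> e e0; have e4 : 0 < e / 4 by lra.
have [x [s [bs ms sT Ts sl]]] := wT _ e4.
have [p ps pg] := Ts _ gT.
pose g' t := g (1 - t).
have g'l t t' : mdist (g' t) (g' t') <= l * `|t' - t|.
  apply: le_trans (gl _ _) _; rewrite (_ : 1 - t' - (1 - t) = t - t'); last by ring.
  by rewrite distrC.
have [v [mv vl vc vg gv]] := lipschitz_chain ler01 e4 g'l.
move: ps bs ms sT Ts sl; case/splitPl => s1 s2 s1p bs ms sT Ts sl.
have sub1 w : {subset x :: s1 ++ s2 <= x :: s1 ++ w ++ s2}.
  by move=> a; rewrite !in_cons !mem_cat => /or3P[->|->|->]; rewrite ?orbT.
have sub2 w w' : {subset w <= x :: s1 ++ (w ++ w') ++ s2}.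
  by move=> a aw; rewrite in_cons !mem_cat aw !orbT.
(* The detour begins at the foot g 1 of the arc, within e/4 of the chain point [p], and runs to [y].
   Out and back it costs at most 2(l + e/4), so with the e/4 of the old walk the excess stays below
   [e]. *)
pose u := g' 0 :: v.
exists x, (s1 ++ (u ++ rev (belast (last x s1) u)) ++ s2); split.
- exact: balanced_insert.
- move: ms; rewrite !cat_path last_cat last_rev_belast => /andP[m1 m2].
  have me : subrel (mesh_le (e / 4)) (mesh_le e : rel X).
    by move=> a b; rewrite /mesh_le; lra.
  rewrite (sub_path me m1) (sub_path me m2) path_mesh_rev.
  have -> : path (mesh_le e) (last x s1) u; last by [].
  rewrite /= (sub_path me mv) andbT s1p /mesh_le /g' subr0 metric_sym.
  by apply: le_trans pg _; lra.
- have uT a : a \in u -> T' a.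
    rewrite inE => /orP[/eqP ->|/vg[t t01 ->]].
      by right; exists 1; rewrite /= ?in_itv/= ?lexx ?ler01// /g' subr0.
    right; exists (1 - t) => //=; move: t01; rewrite !in_itv/=; lra.
  move=> a; rewrite in_cons !mem_cat mem_rev => /or4P[/eqP ->|as1|/orP[au|au]|as2].
  + by left; apply: sT; exact: mem_head.
  + by left; apply: sT; rewrite in_cons mem_cat as1 orbT.
  + exact: uT.
  + move: au => /mem_belast; rewrite in_cons s1p => /orP[/eqP ->|/uT//].
    by left; apply: sT; rewrite -s1p -cat_cons mem_cat mem_last.
  + by left; apply: sT; rewrite in_cons mem_cat as2 !orbT.
- move=> a [/Ts[q qs aq]|[t t01 <-]].
    exists q; last by apply: le_trans aq _; lra.
    exact: sub1.
  have [|q qv tq] := gv (1 - t); first by move: t01; rewrite /= !in_itv/=; lra.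
  exists q; last by move: tq; rewrite /g' subKr; lra.
  exact: sub2.
- rewrite !csum_cat last_cat last_rev_belast csum_rev csum_mdist_sym.
  have : csum mdist (last x s1) u <= e / 4 + l.
    rewrite /= lerD//; last by rewrite subr0 mulr1 in vc.
    by rewrite s1p /g' subr0 metric_sym.
  move: sl; rewrite csum_cat; lra.
Qed.

Lemma walkable_net (ys : seq X) y0 :
  exists T, [/\ closed T, T y0, (forall y, y \in ys -> T y) & walkable T].
Proof.
elim: ys => [|y ys [T [cT T0 Tys wT]]].
  exists [set y0]; split => //.
    by apply: compact_closed; [exact: metric_hausdorff|exact: compact_set1].
  move=> e e0; exists y0, [::]; split => //=.
  - by move=> z; rewrite inE => /eqP.
  - by move=> z ->; exists y0; rewrite ?mem_head// mdistxx ltW.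
  - apply: addr_ge0; last exact: ltW.
    by rewrite mulr_ge0// fine_ge0// hausdorff1_ge0.
have [T' [cT' TT' T'y wT']] := walkable_add y cT T0 wT.
exists T'; split => //; first exact: TT'.
by move=> a; rewrite inE => /orP[/eqP ->//|/Tys /TT'].
Qed.

Lemma balanced_loops (y0 : X) e : 0 < e -> exists x s,
  [/\ balanced x s, path (mesh_le e) x s,
     (forall z, exists2 p, p \in x :: s & mdist z p <= e) &
     csum mdist x s <= 2 * fine (hausdorff1 [set: X]) + e].
Proof.
move=> e0; have e2 : 0 < e / 2 by lra.
have [ys ysP] := compact_finite_net cX e2.
have [T [_ _ Tys wT]] := walkable_net ys y0.
have [x [s [bs ms _ Ts sl]]] := wT _ e2; exists x, s; split => //.
- by apply: sub_path ms => a b; rewrite /mesh_le; lra.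
- move=> z; have [y /Tys/Ts[p ps yp] zy] := ysP z; exists p => //.
  have := metric_triangle z y p; lra.
- apply: le_trans sl _; apply: lerD; last by lra.
  by rewrite ler_pM2l// fine_le ?fin_num_hausdorff1// le_hausdorff1.
Qed.

End loops.

(** * Limit of the balanced loops *)

Section limit_loop.
Context {R : realType} {X : metricType R}.
Hypothesis cX : compact [set: X].
Hypothesis conX : connected [set: X].
Hypothesis Hfin : (hausdorff1 [set: X] < +oo)%E.
Let H := fine (hausdorff1 [set: X]).

Lemma mdist_le_hausdorff1 (x y : X) : mdist x y <= H.
Proof.
rewrite -lee_fin fineK; last exact: fin_num_hausdorff1.
apply: le_trans (hausdorff1_ball_ge conX (lexx (mdist x y))) _.
exact: le_hausdorff1.
Qed.

Lemma trap_close (f g : X -> R) (F G M e : R) (a b a' b' : X) :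
  (forall x y, `|f x - f y| <= F * mdist x y) ->
  (forall x y, `|g x - g y| <= G * mdist x y) -> 0 <= F -> 0 <= G ->
  (forall x, `|f x| <= M) -> mdist a a' <= e -> mdist b b' <= e ->
  `|trap f g a b - trap f g a' b'| <= (2 * F * G * H + 4 * G * M) * e.
Proof.
move=> fF gG F0 G0 fM aa' bb'.
have dec : trap f g a b - trap f g a' b' =
    (f a - f a') * (g b - g a) + (f b - f b') * (g b - g a) +
    (f a' + f b') * (g b - g b') + (f a' + f b') * (g a' - g a).
  by rewrite /trap; ring.
have M0 : 0 <= M := le_trans (normr_ge0 _) (fM a).
have e0 : 0 <= e := le_trans (mdist_ge0 _ _) aa'.
have gba : `|g b - g a| <= G * H.
  by apply: le_trans (gG _ _) _; rewrite ler_wpM2l// mdist_le_hausdorff1.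
have fe x x' : mdist x x' <= e -> `|f x - f x'| <= F * e.
  by move=> xx'; apply: le_trans (fF _ _) _; rewrite ler_wpM2l.
have ge x x' : mdist x x' <= e -> `|g x - g x'| <= G * e.
  by move=> xx'; apply: le_trans (gG _ _) _; rewrite ler_wpM2l.
have f2 : `|f a' + f b'| <= 2 * M.
  apply: le_trans (ler_normD _ _) _; have := fM a'; have := fM b'; lra.
rewrite dec; apply: le_trans (ler_normD _ _) _.
apply: le_trans (lerD (ler_normD _ _) (lexx _)) _.
apply: le_trans (lerD (lerD (ler_normD _ _) (lexx _)) (lexx _)) _.
rewrite !normrM.
have := ler_pM (normr_ge0 _) (normr_ge0 _) (fe _ _ aa') gba.
have := ler_pM (normr_ge0 _) (normr_ge0 _) (fe _ _ bb') gba.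
have := ler_pM (normr_ge0 _) (normr_ge0 _) f2 (ge _ _ bb').
have := ler_pM (normr_ge0 _) (normr_ge0 _) f2 (ge _ _ aa').
rewrite (distrC (g a) (g a')); lra.
Qed.

Lemma limit_loop (y0 : X) (L := 2 * H) : exists g : R -> X,
  [/\ forall t t', mdist (g t) (g t') <= L * `|t' - t|,
      g 0 = g 1,
      forall x, exists2 t, t \in `[0, 1] & g t = x &
      forall (f h : X -> R) (F G : R) (K : nat),
        (forall x y, `|f x - f y| <= F * mdist x y) ->
        (forall x y, `|h x - h y| <= G * mdist x y) -> 0 <= F -> 0 <= G ->
        `|\sum_(i < K.+1) trap f h (g (i%:R / K.+1%:R)) (g (i.+1%:R / K.+1%:R))|
          <= 2 * F * G * L ^+ 2 / K.+1%:R].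
Proof.
have H0 : 0 <= H by rewrite fine_ge0// hausdorff1_ge0.
have L0 : 0 <= L by rewrite mulr_ge0.
pose a n : R := n.+1%:R^-1.
have a0 n : 0 < a n by rewrite invr_gt0.
have a1 n : a n <= 1 by rewrite invf_le1// ler1n.
have amono N n : (N <= n)%N -> a n <= a N by move=> ?; rewrite lef_pV2 ?posrE// ler_nat.
have /choice[xs xsP] (n : nat) : exists xs : X * seq X, [/\ balanced xs.1 xs.2,
    path (mesh_le (a n)) xs.1 xs.2,
    forall z, exists2 p, p \in xs.1 :: xs.2 & mdist z p <= a n &
    csum mdist xs.1 xs.2 <= L + a n].
  by have [x [s ?]] := balanced_loops cX conX Hfin y0 (a0 n); exists (x, s).
have /choice[c cP] (n : nat) := chain_curve (a0 n)
  (let: And4 _ p _ _ := xsP n in p) (let: And4 _ _ _ p := xsP n in p).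
pose f n t := last (xs n).1 (c n t).
have [g fg] := cluster_curve cX f.
have fL n t t' : t <= t' ->
    mdist (f n t) (f n t') <= (L + 2 * a n) * (t' - t) + 2 * a n.
  move=> tt'; have [_ _ /(_ _ _ tt')[u [cu ul]] _ _] := cP n.
  rewrite /f cu last_cat (le_trans (mdist_le_csum _ _))// (le_trans ul)//.
  by rewrite lerD2r ler_wpM2r ?subr_ge0//; lra.
have gL : forall t t', mdist (g t) (g t') <= L * `|t' - t|.
  exact: (cluster_curve_lipschitz fg).
exists g; split => //.
- apply: mdist_positivity; apply/eqP; rewrite eq_le mdist_ge0 andbT.
  apply/ler_addgt0Pr => e e0; have e2 : 0 < e / 2 by lra.
  have [n _ fgn] := fg [:: 0; 1] _ 0%N e2.
  have := fgn 0 (mem_head _ _); have := fgn 1; rewrite !inE eqxx orbT => /(_ isT).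
  rewrite /f; have [-> -> _ _ _] := cP n; have [[-> _] _ _ _] := xsP n.
  have := metric_triangle (g 0) (xs n).1 (g 1).
  rewrite (metric_sym (g 0) (xs n).1) /=; lra.
(* The image is compact, so density suffices: [x] is near a chain point visited at some time [t],
   and [t] is rounded down to the finite grid on which the chain is close to [g]. *)
- move=> x; suff : closure (g @` `[0, 1]) x.
    rewrite -(closure_id _).1; first by move=> [t t01 <-]; exists t.
    apply: compact_closed; first exact: metric_hausdorff.
    apply: continuous_compact; last exact: segment_compact.
    exact: continuous_subspaceT (lipschitz_curve_continuous gL).
  move=> B /nbhs_ballP[e /= e0 eB].
  have c0 : 0 < L + 6 by lra.
  have [N] := ltr_add_invr (divr_gt0 e0 c0); rewrite add0r ltr_pdivlMr// => Ne.
  have [n Nn fgn] :=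
    fg [seq i%:R / N.+1%:R | i <- iota 0 N.+2] (a N) N (a0 N).
  have [_ _ /(_ x)[p ps xp] _] := xsP n.
  have [_ _ _ _ /(_ p ps)[t t01 tp]] := cP n.
  have N0 : 0 < N.+1%:R :> R by rewrite ltr0n.
  pose i := Num.truncn (t * N.+1%:R); pose r : R := i%:R / N.+1%:R.
  move: t01; rewrite in_itv/= => /andP[t0 t1].
  have /andP[it ti] := truncn_itv (mulr_ge0 t0 (ltW N0)).
  have rt : r <= t by rewrite ler_pdivrMr.
  have tr : t - r <= a N.
    have : t <= i.+1%:R / N.+1%:R by rewrite ler_pdivlMr// ltW.
    by rewrite -natr1 mulrDl mul1r -/(a N) -/r; lra.
  have iN : (i <= N.+1)%N.
    by rewrite -(ler_nat R) (le_trans it)// ler_piMl// ltW.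
  exists (g r); split.
    exists r => //=; rewrite in_itv/= divr_ge0//= ?ler0n//.
    by rewrite ler_pdivrMr// mul1r ler_nat.
  apply: eB; rewrite ballEmdist/=.
  have rs : r \in [seq i%:R / N.+1%:R | i <- iota 0 N.+2].
    by apply/mapP; exists i => //; rewrite mem_iota.
  have := fgn _ rs; have := fL n _ _ rt; move: tp; rewrite -/(f n t) => ->.
  have := metric_triangle x p (g r); have := metric_triangle p (f n r) (g r).
  rewrite (metric_sym p (f n r)); have := amono _ _ Nn; have := a0 n; have := a1 n.
  have : (L + 2 * a n) * (t - r) <= (L + 2) * a N.
    by apply: ler_pM => //; have := a0 n; have := a1 n; lra.
  move: Ne xp; rewrite -/(a N); lra.
- move=> u v F G K uF vG F0 G0.
  have K0 : 0 < K.+1%:R :> R by rewrite ltr0n.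
  have K1 : 1 <= K.+1%:R :> R by rewrite ler1n.
  set k := K.+1%:R in K0 K1 *.
  pose M := `|u y0| + F * H.
  have uM x : `|u x| <= M.
    rewrite -[u x](subrK (u y0)) addrC (le_trans (ler_normD _ _))// lerD2l.
    by apply: le_trans (uF _ _) _; rewrite ler_wpM2l// mdist_le_hausdorff1.
  have M0 : 0 <= M := le_trans (normr_ge0 _) (uM y0).
  pose C := 2 * F * G * H + 4 * G * M.
  have C0 : 0 <= C by rewrite addr_ge0// !mulr_ge0.
  (* Coefficient of the error that vanishes as [N] grows with [K] fixed. Each of the [k] pieces
     costs C (a N) by [trap_close]; its length is at most q + 4 (a N) with q = L/k, and the square
     is at most q^2 + (8 L + 16) (a N) because q <= L and a N <= 1. *)
  pose D := k * C + k * (2 * F * G * (8 * L + 16)).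
  have D0 : 0 <= D.
    have L16 : 0 <= 8 * L + 16 by lra.
    by rewrite addr_ge0// !mulr_ge0// ltW.
  apply/ler_addgt0Pr => e e0.
  have D1 : 0 < D + 1 by lra.
  have [N] := ltr_add_invr (divr_gt0 e0 D1); rewrite add0r ltr_pdivlMr// -/(a N) => Ne.
  have [n Nn fgn] := fg [seq i%:R / k | i <- iota 0 K.+2] (a N) N (a0 N).
  pose p (i : nat) : R := i%:R / k.
  have pS i : p i <= p i.+1 by rewrite ler_pM2r ?invr_gt0// ler_nat.
  have pSE i : p i.+1 - p i = k^-1 by rewrite /p -mulrBl -natr1 addrAC subrr add0r mul1r.
  have [c0 c1 cc _ _] := cP n.
  have /choice[w wP] (i : nat) := cc _ _ (pS i).
  have [[_ bal] _ _ _] := xsP n.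
  pose tr := trap u v.
  (* The pieces concatenate to the whole chain, so the sums telescope to its total, which is 0 by
     balance. *)
  have sum0 : \sum_(i < K.+1) csum tr (f n (p i)) (w i) = 0.
    have -> : \sum_(i < K.+1) csum tr (f n (p i)) (w i) =
        \sum_(i < K.+1) (csum tr (xs n).1 (c n (p i.+1)) - csum tr (xs n).1 (c n (p i))).
      by apply: eq_bigr => i _; rewrite (wP i).1 csum_cat addrAC subrr add0r.
    rewrite -(big_mkord xpredT (fun i => csum tr (xs n).1 (c n (p i.+1)) -
      csum tr (xs n).1 (c n (p i)))).
    rewrite telescope_sumr// /p divff ?gt_eqF// mul0r c0 c1 subr0.
    by apply: bal => y z; exact: trapN.
  have close i : (i < K.+1)%N ->
      `|tr (g (p i)) (g (p i.+1)) - csum tr (f n (p i)) (w i)| <=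
      C * a N + 2 * F * G * ((L / k) ^+ 2 + (8 * L + 16) * a N).
    move=> iK; have pin j : (j < K.+2)%N -> mdist (g (p j)) (f n (p j)) <= a N.
      move=> jK; rewrite metric_sym ltW// fgn//; apply/mapP; exists j => //.
      by rewrite mem_iota.
    have h1 := trap_close uF vG F0 G0 uM (pin i (leqW iK)) (pin i.+1 iK).
    have h2 := csum_trap (f n (p i)) (w i) uF vG F0 G0.
    have lw : last (f n (p i)) (w i) = f n (p i.+1).
      by rewrite /f (wP i).1 last_cat.
    rewrite lw in h2.
    have lenw : csum mdist (f n (p i)) (w i) <= L / k + 4 * a N.
      have := (wP i).2; rewrite -/(f n (p i)) pSE => h.
      have anN := amono _ _ Nn; have := a0 n => an0.
      have : (L + a n + a n) / k <= L / k + 2 * a N.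
        rewrite -addrA mulrDl lerD2l ler_pdivrMr//.
        by apply: (@le_trans _ _ (2 * a N * 1)); [lra|rewrite ler_pM2l//; lra].
      move=> h4; apply: le_trans h _; apply: le_trans (lerD h4 (lexx _)) _.
      by rewrite -addrA lerD2l; lra.
    have len2 : csum mdist (f n (p i)) (w i) ^+ 2 <= (L / k) ^+ 2 + (8 * L + 16) * a N.
      have s0 := csum_mdist_ge0 (f n (p i)) (w i).
      have aN0 := a0 N; have aN1 := a1 N.
      have Lk0 : 0 <= L / k by rewrite divr_ge0// ltW.
      have LkL : L / k <= L by rewrite ler_pdivrMr// ler_peMr.
      move: (L / k) Lk0 LkL lenw => q Lk0 LkL lenw.
      apply: (@le_trans _ _ ((q + 4 * a N) ^+ 2)).
        by rewrite ler_sqr ?nnegrE//; lra.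
      rewrite sqrrD -addrA lerD2l.
      have : q * a N <= L * a N by rewrite ler_wpM2r// ltW.
      have : a N * a N <= 1 * a N by rewrite ler_wpM2r// ltW.
      rewrite exprMn -[a N ^+ 2]/(a N * a N) -[4 ^+ 2]/(4 * 4); lra.
    have := ler_wpM2l (mulr_ge0 (mulr_ge0 (ler0n R 2) F0) G0) len2.
    have -> : tr (g (p i)) (g (p i.+1)) - csum tr (f n (p i)) (w i) =
       (tr (g (p i)) (g (p i.+1)) - tr (f n (p i)) (f n (p i.+1))) -
       (csum tr (f n (p i)) (w i) - tr (f n (p i)) (f n (p i.+1))) by ring.
    move=> h3; apply: le_trans (ler_normB _ _) _.
    by apply: lerD => //; apply: le_trans h2 h3.
  rewrite -[X in `|X|]subr0 -[X in _ - X]sum0 -sumrB (le_trans (ler_norm_sum _ _ _))//.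
  apply: le_trans (ler_sum _ (fun (i : 'I_K.+1) _ => close i (ltn_ord i))) _.
  rewrite sumr_const card_ord -[leLHS]mulr_natr -/k.
  have -> : (C * a N + 2 * F * G * ((L / k) ^+ 2 + (8 * L + 16) * a N)) * k =
      2 * F * G * L ^+ 2 / k + D * a N.
    by rewrite /D; field; rewrite gt_eqF.
  rewrite lerD2l; have := a0 N; move: Ne; rewrite mulrDr mulr1 [a N * D]mulrC; lra.
Qed.

End limit_loop.

(** * Degree zero and multiple points *)

Section lipschitz_density.
Context {R : realType}.
Notation mu := (@lebesgue_measure R).
Implicit Types (h : R -> R) (a b t L : R).

(** A cover of [A] by intervals of small total length has small total F-length. The factor [|L| + 1]
    is positive whatever [L] is. *)
Lemma lebesgue_stieltjes_dominated (F : cumulative R R) L :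
  (forall s t, s <= t -> F t - F s <= L * (t - s)) ->
  forall A : set R, mu A = 0%E -> lebesgue_stieltjes_measure F A = 0%E.
Proof.
move=> FL A muA; apply/eqP; rewrite eq_le measure_ge0 andbT.
apply/lee_addgt0Pr => e e0; rewrite add0e.
have L1 : 0 < `|L| + 1 by rewrite ltr_wpDl.
have : (mu A < (e / (`|L| + 1))%:E)%E by rewrite muA lte_fin divr_gt0.
move=> /ereal_inf_lt[_ [B [mB AB] <-] Be].
apply: (@le_trans _ _ (\sum_(0 <= k <oo) wlength F (B k))%E).
  by apply: ereal_inf_lbound; exists B.
apply: (@le_trans _ _ (\sum_(0 <= k <oo) (`|L| + 1)%:E * wlength idfun (B k))%E).
  apply: lee_nneseries => k _; first by move=> _; exact: wlength_ge0.
  have [[x y] _ /= <-] := mB k.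
  have [xy|yx] := leP x y; last first.
    by rewrite set_itv_ge ?bnd_simp -?leNgt ?(ltW yx)// !wlength0 mule0.
  rewrite !wlength_itv_bnd// -EFinM lee_fin (le_trans (FL _ _ xy))//.
  by rewrite ler_wpM2r ?subr_ge0// (le_trans (ler_norm L))// lerDl.
rewrite nneseriesZl; last by move=> k _; exact: wlength_ge0.
apply: (@le_trans _ _ ((`|L| + 1)%:E * (e / (`|L| + 1))%:E)%E).
  by rewrite lee_pmul2l// ltW.
by rewrite -EFinM lee_fin mulrC divfK// gt_eqF.
Qed.


Lemma ftc_lebesgue_pt (f h : R -> R) (c a u : R) :
  mu.-integrable `[a, u] (EFin \o f) ->
  (forall y, a < y -> y < u -> (\int[mu]_(t in `[a, y]) f t)%R + c = h y) ->
  forall t, a < t -> t < u -> lebesgue_pt f t ->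
  derivable h t 1 /\ derive1 h t = f t.
Proof.
move=> intf fh t a_t tu pt.
have [|dG Gt] := @FTC1_lebesgue_pt R f (BLeft a) t u tu intf _ pt.
  by rewrite lte_fin.
set G := (fun y => _) in dG Gt.
have nearE : {near t, (fun y => G y + c) =1 h}.
  near=> y; apply: fh; first by near: y; exact: lt_nbhsr.
  by near: y; exact: lt_nbhsl.
have dGc : derivable (fun y => G y + c) t 1.
  move: dG; rewrite /derivable; set q := (X in cvg (X @ _) -> _).
  set q' := (X in _ -> cvg (X @ _)).
  have -> // : q' = q.
  by apply/funext => k; rewrite /q /q' /= opprD addrACA subrr addr0.
split; first exact: (near_eq_derivable nearE dGc).
rewrite derive1E -(near_eq_derive _ nearE) -derive1E -Gt /derive1.
set q := (X in lim (X @ _)); set q' := (X in _ = lim (X @ _)).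
have -> // : q = q'.
by apply/funext => k; rewrite /q /q' /= opprD addrACA subrr addr0.
Unshelve. all: by end_near. Qed.

(* Radon-Nikodym applied to the Lebesgue-Stieltjes measure of h(t) + L t, which
   is nondecreasing and 2L-Lipschitz. *)
Lemma lipschitz_density h L : 0 <= L ->
  (forall s t, `|h s - h t| <= L * `|s - t|) ->
  exists phi : R -> R, [/\ measurable_fun setT phi, forall t, `|phi t| <= L,
    forall a b, 0 <= a -> a <= b -> b <= 1 ->
      (h b - h a)%:E = (\int[mu]_(t in `[a, b]) (phi t)%:E)%E &
    forall t, 0 < t -> t < 1 -> lebesgue_pt phi t ->
      derivable h t 1 /\ derive1 h t = phi t].
Proof.
move=> L0 hL.
have Hle s t : s <= t -> h s + L * s <= h t + L * t.
  move=> st; have := hL t s; rewrite (ger0_norm (_ : 0 <= t - s)) ?subr_ge0// ler_distl.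
  by move=> /andP[]; lra.
have H2 s t : s <= t -> (h t + L * t) - (h s + L * s) <= 2 * L * (t - s).
  move=> st; have := hL t s; rewrite (ger0_norm (_ : 0 <= t - s)) ?subr_ge0// ler_distl.
  by move=> /andP[]; lra.
have ch : continuous (fun t => h t + L * t).
  apply: (@lipschitz_real_continuous R R^o _ (2 * L)) => x y /=.
  rewrite /mdist/= ler_norml; have [xy|/ltW yx] := leP x y.
    by rewrite ger0_norm ?subr_ge0//; have := H2 _ _ xy; have := Hle _ _ xy; lra.
  by rewrite ler0_norm ?subr_le0//; have := H2 _ _ yx; have := Hle _ _ yx; lra.
pose F : cumulative R R := HB.pack_for (cumulative R R) (fun t => h t + L * t)
  (isCumulative.Build R _ R _ Hle (right_continuousW ch)).
pose nuF : measure _ _ := lebesgue_stieltjes_measure F.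
have nuE a b : a <= b -> nuF `]a, b]%classic = (F b - F a)%:E.
  move=> ab; rewrite /nuF/= /lebesgue_stieltjes_measure /measure_extension.
  by rewrite measurable_mu_extE/= ?wlength_itv_bnd//; exact: is_ocitv.
(* A bounded window makes the measure finite; it contains [0, 1] in its interior, so the endpoints
   cause no trouble. *)
pose D : set (measurableTypeR R) := `](-1), 2]%classic.
have mD : measurable D by exact: measurable_itv.
have Doo : (nuF D < +oo)%E by rewrite nuE ?ltry//; lra.
pose nu : {finite_measure set (measurableTypeR R) -> \bar R} := mfrestr mD Doo.
have nu_mu : nu `<< mu.
  apply/null_content_dominatesP => A mA A0; apply/eqP.
  rewrite eq_le measure_ge0 andbT; apply: (@le_trans _ _ (nuF A)).
    by apply: (@le_measure _ _ _ nuF); rewrite ?inE//; exact: measurableI.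
  by rewrite /nuF/= (@lebesgue_stieltjes_dominated F (2 * L)).
have [f [f0 ffin fint nuf]] := radon_nikodym_sigma_finite nu_mu.
pose psi t := fine (f t).
have psi0 t : 0 <= psi t by rewrite fine_ge0.
have psiE t : (psi t)%:E = f t by rewrite fineK.
have psiint : mu.-integrable setT (EFin \o psi).
  by rewrite (_ : EFin \o psi = f)//; apply/funext => t; exact: psiE.
have locpsi : locally_integrable setT psi.
  by apply: open_integrable_locally => //; exact: openT.
have psioc a b : -1 <= a -> a <= b -> b <= 2 ->
    (\int[mu]_(t in `]a, b]) (psi t)%:E)%E = (F b - F a)%:E.
  move=> a1 ab b2; under eq_integral do rewrite psiE.
  rewrite -nuf; last exact: measurable_itv.
  have -> : nu `]a, b]%classic = nuF (`]a, b]%classic `&` D) by [].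
  rewrite setIidl ?nuE// => t; rewrite /D /= !in_itv/= => /andP[]; lra.
have psicc a b : -1 <= a -> a <= b -> b <= 2 ->
    (\int[mu]_(t in `[a, b]) (psi t)%:E)%E = (F b - F a)%:E.
  move=> a1 ab b2; rewrite -psioc// -integral_itv_obnd_cbnd//.
  exact: measurable_funS (measurable_int _ psiint).
(* At Lebesgue points the density is the derivative of [F], whose difference quotients are at most 2
   L. *)
have psi2 : {ae mu, forall t, -1 < t -> t < 2 -> psi t <= 2 * L}.
  move: (lebesgue_differentiation locpsi).
  apply: filterS; first exact: (ae_filter_ringOfSetsType mu).
  move=> t pt t1 t2.
  have [||dF <-] := @ftc_lebesgue_pt psi F (F (-1)) (-1) 2 _ _ t t1 t2 pt.
  - by apply: integrableS psiint => //; exact: measurable_itv.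
  - move=> y y1 y2; rewrite /Rintegral psicc ?(ltW y1) ?(ltW y2)//=; lra.
  rewrite derive1E /derive.
  apply: (closed_cvg (fun y : R => y <= 2 * L) (@closed_le R (2 * L)) _ _ dF).
  near=> k; have : k != 0 by near: k; exact: nbhs_dnbhs_neq.
  rewrite /= [k *: 1]mulr1 neq_lt => /orP[k0|k0].
    rewrite -[k^-1 *: _]/(k^-1 * _) ler_ndivrMl//.
    by have := @H2 (k + t) t; rewrite -/(F (k + t)) -/(F t); lra.
  rewrite -[k^-1 *: _]/(k^-1 * _) ler_pdivrMl//.
  by have := @H2 t (k + t); rewrite -/(F (k + t)) -/(F t); lra.
(* By [psi2] the truncation alters [psi] only on a null subset of ]-1, 2[, and it yields the bound
   at every time instead of almost every time. Subtracting [L] removes the added slope. *)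
pose phi t := Num.min (psi t) (2 * L) - L.
have phiL t : `|phi t| <= L.
  rewrite ler_norml /phi; have := psi0 t; rewrite lerBlDr lerBrDr.
  rewrite ge_min le_min; lra.
have mpsi : measurable_fun setT psi by apply/measurable_EFinP; exact: measurable_int psiint.
have mphi : measurable_fun setT phi.
  by apply: measurable_funB => //; exact: measurable_minr.
have phicc a b : -1 < a -> a <= b -> b < 2 ->
    (\int[mu]_(t in `[a, b]) (phi t)%:E)%E = (h b - h a)%:E.
  move=> a1 ab b2; have mab : measurable (`[a, b]%classic : set R).
    exact: measurable_itv.
  transitivity (\int[mu]_(t in `[a, b]) ((psi t)%:E - (cst L t)%:E))%E.
    apply: ae_eq_integral => //.
    - by apply/measurable_EFinP; exact: measurable_funTS.
    - by apply/measurable_EFinP; apply: measurable_funTS; exact: measurable_funB.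
    move: psi2; apply: filterS; first exact: (ae_filter_ringOfSetsType mu).
    move=> t pt; rewrite /= in_itv/= => /andP[a_t tb].
    by rewrite /phi (min_idPl (pt _ _))//; lra.
  rewrite integralB_EFin//.
  - rewrite psicc ?(ltW a1) ?(ltW b2)//.
    rewrite -[X in (_ - X)%E]/(\int[mu]_(t in `[a, b]) cst L%:E t)%E.
    rewrite integral_cst//= lebesgue_measure_itv/= lte_fin.
    have <- : (b - a)%:E = (if a < b then (b%:E - a%:E)%E else 0%E).
      case: ltP => // ba; congr EFin; lra.
    by rewrite -EFinM -EFinB; congr EFin; lra.
  - exact: integrableS psiint.
  - apply: measurable_bounded_integrable => //.
    by rewrite /= lebesgue_measure_itv/=; case: ifP => _; rewrite ?ltry.
    by exists L; split; rewrite ?num_real// => M LM t _ /=; rewrite ger0_norm// ltW.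
exists phi; split => //.
- by move=> a b a0 ab b1; rewrite phicc//; lra.
- move=> t t0 t1 pt; have s1 : -1 < - 2^-1 :> R by lra.
  have s2 : 3 / 2 < 2 :> R by lra.
  apply: (@ftc_lebesgue_pt phi h (h (- 2^-1)) (- 2^-1) (3 / 2)) => //; try lra.
    apply: measurable_bounded_integrable => //.
    + by rewrite /= lebesgue_measure_itv/=; case: ifP => _; rewrite ?ltry.
    + exact: measurable_funTS.
    + exists L; split; rewrite ?num_real// => M LM y _.
      by rewrite /= (le_trans (phiL y))// ltW.
  move=> y y1 y2; rewrite /Rintegral phicc//= ?subrK//; lra.
Unshelve. all: by end_near. Qed.

End lipschitz_density.

(** * Integrals modified on null sets *)

Section ae_integral.
Context d (T : measurableType d) (R : realType).
Variable mu : {measure set T -> \bar R}.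
Import HBNNSimple.
Local Open Scope ereal_scope.

(** Meant for the derivative in [path_integral], which comes without a proof of measurability. A
    simple function below [f] can be set to 0 on [N] without changing its integral, and then lies
    below [g]. *)
Lemma ge0_le_integral_off_null (D N : set T) (f g : T -> \bar R) :
  measurable N -> mu N = 0 -> (forall x, D x -> 0 <= f x) ->
  (forall x, D x -> 0 <= g x) -> (forall x, D x -> ~ N x -> f x <= g x) ->
  \int[mu]_(x in D) f x <= \int[mu]_(x in D) g x.
Proof.
move=> mN N0 f0 g0 fg; rewrite integral_mkcond [leRHS]integral_mkcond.
rewrite [leLHS]ge0_integralTE; last first.
  by move=> x; rewrite /patch; case: ifPn => // /set_mem/f0.
have gD0 x : 0 <= (g \_ D) x by rewrite /patch; case: ifPn => // /set_mem/g0.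
apply: ge_ereal_sup => _ [h hf <-].
rewrite -integralT_nnsfun.
have mh : measurable_fun setT (EFin \o h) by apply/measurable_EFinP.
have mNC : measurable (~` N) by exact: measurableC.
have -> : \int[mu]_x (h x)%:E = \int[mu]_x (proj_nnsfun h mNC x)%:E.
  apply: ae_eq_integral => //; first exact/measurable_EFinP.
  exists N; split => // x /= /not_implyP[_ hx]; apply: contrapT => Nx.
  by apply: hx; rewrite mindicE mem_set ?mulr1.
rewrite integralT_nnsfun [leRHS]ge0_integralTE//.
apply: ereal_sup_ubound; exists (proj_nnsfun h mNC) => // x.
rewrite /= mindicE; have [/set_mem Nx|Nx] := boolP (x \in ~` N); last first.
  by rewrite mulr0.
rewrite mulr1; apply: le_trans (hf x) _; rewrite /patch.
by case: ifPn => // /set_mem Dx; exact: fg.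
Qed.

Lemma eq_integral_off_null (D N : set T) (f g : T -> \bar R) :
  measurable N -> mu N = 0 -> (forall x, D x -> ~ N x -> f x = g x) ->
  \int[mu]_(x in D) f x = \int[mu]_(x in D) g x.
Proof.
move=> mN N0 fg; rewrite integralE [RHS]integralE.
by congr (_ - _); apply/eqP; rewrite eq_le; apply/andP; split;
  apply: (@ge0_le_integral_off_null D N) => // x Dx Nx;
  rewrite ?funepos.unlock ?funeneg.unlock /= fg.
Qed.

End ae_integral.

Section bounded_integrable.
Context {R : realType}.
Notation mu := (@lebesgue_measure R).

Lemma bounded_itv_integrable (i : interval R) (f : R -> R) (M : R) :
  (mu [set` i] < +oo)%E -> measurable_fun setT f ->
  (forall t, t \in i -> `|f t| <= M) -> mu.-integrable [set` i] (EFin \o f).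
Proof.
move=> ioo mf fM; apply: measurable_bounded_integrable => //.
  exact: measurable_funTS.
exists M; split; rewrite ?num_real// => M' MM' t ti /=.
by rewrite (le_trans (fM t ti))// ltW.
Qed.

Lemma lebesgue_measure_itv_lty (a b : R) (x y : bool) :
  (mu [set` Interval (BSide x a) (BSide y b)] < +oo)%E.
Proof. by rewrite lebesgue_measure_itv/=; case: ifP => _; rewrite ?ltry. Qed.

(** On [a, b] the function [u] stays within U(b - a) of the mean of its end values, and this
    constant comes out of the integral. *)
Lemma Rintegral_trapezoid (u phi h : R -> R) (a b U P : R) : a <= b ->
  measurable_fun setT u -> measurable_fun setT phi ->
  (forall s t, `|u s - u t| <= U * `|s - t|) -> (forall t, `|phi t| <= P) ->
  (h b - h a = \int[mu]_(t in `[a, b]) phi t) ->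
  `|\int[mu]_(t in `[a, b]) (u t * phi t) - (u a + u b) / 2 * (h b - h a)| <=
    U * P * (b - a) ^+ 2.
Proof.
move=> ab mu_ mphi uU phiP hab; have ba : 0 <= b - a by rewrite subr_ge0.
have P0 : 0 <= P := le_trans (normr_ge0 _) (phiP 0).
have U0 : 0 <= U by have := le_trans (normr_ge0 _) (uU 1 0); rewrite subr0 normr1 mulr1.
set c := (u a + u b) / 2.
have uc t : t \in `[a, b] -> `|u t - c| <= U * (b - a).
  rewrite in_itv/= => /andP[ta tb]; have := uU t a; have := uU t b.
  rewrite (ger0_norm (_ : 0 <= t - a)) ?subr_ge0//.
  rewrite (ler0_norm (_ : t - b <= 0)) ?subr_le0// => h1 h2.
  have := ler_wpM2l U0 (_ : t - a <= b - a); rewrite lerD2r => /(_ tb) h3.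
  have := ler_wpM2l U0 (_ : - (t - b) <= b - a); rewrite opprB lerB// => /(_ isT) h4.
  move: h1 h2 h3 h4; rewrite !ler_norml /c => /andP[a1 a2] /andP[a3 a4].
  by rewrite opprB in a1 a2 *; lra.
have iphi : mu.-integrable `[a, b] (EFin \o phi).
  exact: bounded_itv_integrable (lebesgue_measure_itv_lty _ _ _ _) mphi (fun t _ => phiP t).
have muphi : measurable_fun setT (fun t => u t * phi t) by exact: measurable_funM.
have iuphi : mu.-integrable `[a, b] (EFin \o (fun t => u t * phi t)).
  apply: (@bounded_itv_integrable _ _ ((U * (b - a) + `|c|) * P)) => //.
    exact: lebesgue_measure_itv_lty.
  move=> t tab; rewrite normrM ler_pM// -[u t](subrK c).
  by rewrite (le_trans (ler_normD _ _))// lerD2r uc.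
have icphi : mu.-integrable `[a, b] (EFin \o (fun t => c * phi t)).
  apply: (@bounded_itv_integrable _ _ (`|c| * P)).
  - exact: lebesgue_measure_itv_lty.
  - by apply: measurable_funM => //; exact: measurable_cst.
  - by move=> t _; rewrite normrM ler_wpM2l.
have mab : measurable (`[a, b]%classic : set (measurableTypeR R)).
  exact: measurable_itv.
rewrite hab -RintegralZl// -RintegralB//.
have ->: \int[mu]_(t in `[a, b]) (u t * phi t - c * phi t) =
  \int[mu]_(t in `[a, b]) ((u t - c) * phi t).
  by apply: eq_Rintegral => t _; rewrite mulrBl.
have bd t : t \in `[a, b] -> `|(u t - c) * phi t| <= U * (b - a) * P.
  by move=> tab; rewrite normrM ler_pM// uc.
have md : measurable_fun setT (fun t => (u t - c) * phi t).
  by apply: measurable_funM => //; exact: measurable_funB.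
have imd := bounded_itv_integrable (lebesgue_measure_itv_lty a b true false) md bd.
apply: le_trans (le_normr_Rintegral mab imd) _.
apply: (@le_trans _ _ (\int[mu]_(t in `[a, b]) (U * (b - a) * P))).
  apply: le_Rintegral => //.
  - apply: bounded_itv_integrable (lebesgue_measure_itv_lty _ _ _ _) _ _.
      by apply: measurableT_comp.
    by move=> t /bd; rewrite normr_id; exact.
  - apply: (@bounded_itv_integrable _ _ `|U * (b - a) * P|) => //.
    exact: lebesgue_measure_itv_lty.
have mE : fine (mu `[a, b]%classic) = b - a.
  by rewrite lebesgue_measure_itv/= lte_fin; case: ltP => //= ba'; lra.
rewrite Rintegral_cst// -[fine _]/(fine (mu `[a, b]%classic)) mE expr2; lra.
Qed.

End bounded_integrable.

Section degree_zero.
Context {R : realType} {X : metricType R}.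
Notation mu := (@lebesgue_measure R).

Lemma lipschitz_mapP (f : X -> R) : @lipschitz_map R X R^o setT f ->
  exists2 F, 0 <= F & forall x y, `|f x - f y| <= F * mdist x y.
Proof.
move=> [F fF]; exists `|F| => // x y; rewrite distrC.
by rewrite (le_trans (fF x y I I))// ler_wpM2r ?mdist_ge0// ler_norm.
Qed.

Lemma locally_integrable_bounded (phi : R -> R) (M : R) :
  measurable_fun setT phi -> (forall t, `|phi t| <= M) ->
  locally_integrable setT phi.
Proof.
move=> mphi phiM; split => //; first exact: openT.
move=> K _ cK; have mK : measurable (K : set (measurableTypeR R)).
  exact: compact_measurable.
have /integrableP[_] : mu.-integrable K (EFin \o phi).
  apply: measurable_bounded_integrable => //.
  - exact: compact_finite_measure.
  - exact: measurable_funTS.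
  - exists M; split; rewrite ?num_real// => M' MM' t _ /=.
    by rewrite (le_trans (phiM t))// ltW.
by [].
Qed.

Variables (g : R -> X) (L : R).
Hypothesis L0 : 0 <= L.
Hypothesis gL : forall t t', mdist (g t) (g t') <= L * `|t' - t|.

Lemma lipschitz_comp (f : X -> R) (F : R) : 0 <= F ->
  (forall x y, `|f x - f y| <= F * mdist x y) ->
  forall s t, `|f (g s) - f (g t)| <= F * L * `|s - t|.
Proof.
move=> F0 fF s t; apply: le_trans (fF _ _) _; rewrite -mulrA ler_wpM2l//.
by rewrite distrC.
Qed.

Lemma lipschitz_measurable (h : R -> R) (H : R) :
  (forall s t, `|h s - h t| <= H * `|s - t|) -> measurable_fun setT h.
Proof.
move=> hH; apply: continuous_measurable_fun.
apply: (@lipschitz_real_continuous R R^o h H) => x y.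
by rewrite /mdist/= distrC -[`|y - x|]distrC distrC.
Qed.

Lemma degree_zeroP :
  (forall (f h : X -> R) (F G : R) (K : nat),
    (forall x y, `|f x - f y| <= F * mdist x y) ->
    (forall x y, `|h x - h y| <= G * mdist x y) -> 0 <= F -> 0 <= G ->
    `|\sum_(i < K.+1) trap f h (g (i%:R / K.+1%:R)) (g (i.+1%:R / K.+1%:R))|
      <= 2 * F * G * L ^+ 2 / K.+1%:R) ->
  forall f k : X -> R, @lipschitz_map R X R^o setT f ->
    @lipschitz_map R X R^o setT k ->
  forall phi : R -> R, measurable_fun setT phi ->
    (exists P, forall t, `|phi t| <= P) ->
    (forall a b, 0 <= a -> a <= b -> b <= 1 ->
      (k (g b) - k (g a))%:E = (\int[mu]_(t in `[a, b]) (phi t)%:E)%E) ->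
    \int[mu]_(t in `[0, 1]) (f (g t) * phi t) = 0.
Proof.
move=> traps f k /lipschitz_mapP[F F0 fF] /lipschitz_mapP[G G0 kG] phi mphi.
move=> [P phiP] kphi; set J := Rintegral _ _ _.
have uL := lipschitz_comp F0 fF; have mu_ := lipschitz_measurable uL.
have P0 : 0 <= P := le_trans (normr_ge0 _) (phiP 0).
(* First term: the trapezoidal error summed over [n.+1] pieces of length 1/(n + 1). Second term:
   half the bound [traps], since [trap] is twice the trapezoidal rule. *)
pose C := F * L * P + F * G * L ^+ 2.
have C0 : 0 <= C by rewrite addr_ge0// !mulr_ge0// sqr_ge0.
suff JC n : `|J| <= C / n.+1%:R.
  apply/eqP; rewrite -normr_eq0 eq_le normr_ge0 andbT.
  apply/ler_addgt0Pr => e e0; rewrite add0r.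
  have C1 : 0 < C + 1 by lra.
  have [n] := ltr_add_invr (divr_gt0 e0 C1); rewrite add0r ltr_pdivlMr// => ne.
  apply: le_trans (JC n) _; have : 0 < n.+1%:R^-1 :> R by rewrite invr_gt0.
  move: ne; move: (n.+1%:R^-1) => a; lra.
have n0 : 0 < n.+1%:R :> R by rewrite ltr0n.
pose p (i : nat) : R := i%:R / n.+1%:R.
have p0 : p 0%N = 0 by rewrite /p mul0r.
have pn : p n.+1 = 1 by rewrite /p divff// gt_eqF.
have pS i : p i <= p i.+1 by rewrite ler_pM2r ?invr_gt0// ler_nat.
have pSE i : p i.+1 - p i = n.+1%:R^-1 by rewrite /p -mulrBl -natr1 addrAC subrr add0r mul1r.
have p_ge0 i : 0 <= p i by rewrite divr_ge0.
have p_le1 i : (i <= n.+1)%N -> p i <= 1 by move=> ?; rewrite ler_pdivrMr// mul1r ler_nat.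
pose I i := \int[mu]_(t in `[p i, p i.+1]) (f (g t) * phi t).
have fM : exists M, forall t, t \in `[0, 1] -> `|f (g t)| <= M.
  exists (`|f (g 0)| + F * L) => t; rewrite in_itv/= => /andP[t0 t1].
  rewrite -[f (g t)](subrK (f (g 0))) addrC (le_trans (ler_normD _ _))// lerD2l.
  apply: le_trans (uL t 0) _; rewrite subr0 ger0_norm// ler_piMr// mulr_ge0//.
have intI (b : R) : b <= 1 -> mu.-integrable `[0, b] (EFin \o (fun t => f (g t) * phi t)).
  move=> b1; have [M fM'] := fM; apply: (@bounded_itv_integrable _ _ _ (M * P)).
  - exact: lebesgue_measure_itv_lty.
  - exact: measurable_funM.
  - move=> t tb; rewrite normrM ler_pM// fM'//; move: tb; rewrite !in_itv/=; lra.
have sumI : J = \sum_(i < n.+1) I i.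
  suff H m : (m <= n.+1)%N -> \int[mu]_(t in `[0, p m]) (f (g t) * phi t) = \sum_(i < m) I i.
    by rewrite -H// pn.
  elim: m => [_|m IH mn]; first by rewrite big_ord0 p0 set_itv1 Rintegral_set1.
  rewrite big_ord_recr/= -IH ?(ltnW mn)//.
  rewrite -[LHS](subrK (\int[mu]_(t in `[0, p m]) (f (g t) * phi t))) addrC; congr (_ + _).
  rewrite (@Rintegral_itvB _ _ (BLeft 0) (BRight (p m.+1)) (p m)) ?bnd_simp//.
    rewrite Rintegral_itv_obnd_cbnd//.
    apply: integrableS (intI _ (p_le1 _ mn)) => //.
    apply: subset_itvr; rewrite bnd_simp; exact: p_ge0.
  exact/intI/p_le1.
have Iclose (i : 'I_n.+1) :
    `|I i - 2^-1 * trap f k (g (p i)) (g (p i.+1))| <= F * L * P * n.+1%:R^-1 ^+ 2.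
  rewrite -(pSE i).
  have -> : 2^-1 * trap f k (g (p i)) (g (p i.+1)) =
    (f (g (p i)) + f (g (p i.+1))) / 2 * (k (g (p i.+1)) - k (g (p i))).
    by rewrite /trap; ring.
  apply: (@Rintegral_trapezoid _ (f \o g) phi (k \o g)) => //.
  by rewrite /Rintegral -kphi// p_le1.
have := traps f k F G n fF kG F0 G0; set S := \sum_(i < n.+1) trap _ _ _ _ => hS.
have -> : J = (\sum_(i < n.+1) (I i - 2^-1 * trap f k (g (p i)) (g (p i.+1)))) + 2^-1 * S.
  by rewrite sumI sumrB -mulr_sumr subrK.
apply: le_trans (ler_normD _ _) _.
rewrite /C mulrDl; apply: lerD.
  apply: le_trans (ler_norm_sum _ _ _) _; apply: le_trans (ler_sum _ (fun i _ => Iclose i)) _.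
  rewrite sumr_const card_ord -[leLHS]mulr_natr expr2 -!mulrA mulVf ?gt_eqF// mulr1.
  by rewrite !mulrA.
rewrite normrM ger0_norm ?invr_ge0//.
apply: le_trans (ler_wpM2l _ hS) _; first by rewrite invr_ge0.
by rewrite !mulrA mulVf ?mul1r.
Qed.

End degree_zero.

Lemma compact_dense_sequence (R : realType) (X : metricType R) (y0 : X) :
  compact [set: X] -> exists xs : nat -> X, forall z (e : R), 0 < e ->
    exists i, mdist z (xs i) < e.
Proof.
move=> cX.
have /choice[ys ysP] (n : nat) :=
  compact_finite_net cX (ltac:(by rewrite invr_gt0) : 0 < n.+1%:R^-1 :> R).
exists (fun i => if @unpickle (nat * nat)%type i is Some p then nth y0 (ys p.1) p.2
                 else y0).
move=> z e e0; have [n] := ltr_add_invr e0; rewrite add0r => ne.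
have [y yys zy] := ysP n z; exists (pickle (n, index y (ys n))).
by rewrite pickleK/= nth_index// (lt_trans zy).
Qed.

(** * Images of sets of times on which the curve stands still *)

Section image_null.
Context {R : realType} {X : metricType R}.
Notation mu := (@lebesgue_measure R).

(** Cover [Z] by intervals of small total excess over [Z]. By hypothesis the image of each has
    diameter at most [K] times its own excess, so the diameters have a small sum even if [Z] is
    large. *)
Lemma hausdorff1_image_null (g : R -> X) (K : R) (Z : set (measurableTypeR R)) :
  0 <= K -> measurable Z -> Z `<=` `[0, 1]%classic ->
  (forall a b, 0 <= a -> a <= b -> b <= 1 ->
    ((mdist (g a) (g b))%:E <= K%:E * mu (`[a, b] `\` Z))%E) ->
  hausdorff1 (g @` Z) = 0%E.
Proof.
move=> K0 mZ Z01 gK; apply/eqP; rewrite eq_le hausdorff1_ge0 andbT.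
have Zfin : mu Z \is a fin_num.
  rewrite ge0_fin_numE//; apply: le_lt_trans (lebesgue_measure_itv_lty 0 1 true false).
  by apply: le_measure; rewrite ?inE.
apply: hausdorff1_le => d d0; apply/lee_addgt0Pr => e e0; rewrite add0e.
have K1 : 0 < K + 1 by lra.
(* One bound on the total excess serves twice: each diameter is at most [d], and their sum at most
   [e]. *)
pose c := Num.min d e / (K + 1).
have c0 : 0 < c by rewrite divr_gt0// lt_min d0.
have : (mu Z < mu Z + c%:E)%E by rewrite lteDl.
move=> /ereal_inf_lt[_ [A [mA ZA] <-] Ac].
have mA' i : measurable (A i : set (measurableTypeR R)) by exact: sub_sigma_algebra.
have lenA i : wlength idfun (A i) = mu (A i).
  by rewrite /lebesgue_measure /lebesgue_stieltjes_measure /measure_extension measurable_mu_extE.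
have sumD : (\sum_(0 <= i <oo) mu (A i `\` Z) <= c%:E)%E.
  have ZI : (mu Z <= \sum_(0 <= i <oo) mu (A i `&` Z))%E.
    apply: measure_sigma_subadditive => //; first by move=> i; exact: measurableI.
    by move=> t Zt; have [i _ At] := ZA _ Zt; exists i.
  have : (\sum_(0 <= i <oo) mu (A i `\` Z) + mu Z <= mu Z + c%:E)%E.
    apply: le_trans (ltW Ac); apply: le_trans (leeD2l _ ZI) _.
    rewrite -nneseriesD//; apply: lee_nneseries => // i _.
      by move=> _; rewrite adde_ge0.
    apply: (@le_trans _ _ (mu (A i))); last by rewrite -lenA.
    rewrite -measureU//.
    - by rewrite -setDDr setDv setD0 le_measure// ?inE.
    - exact: measurableD.
    - exact: measurableI.
    - by rewrite setDE setIACA setICl !setI0.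
  by rewrite addeC leeD2lE.
pose F i := g @` (A i `&` `[0, 1]).
have diamF i : (diam (F i) <= K%:E * mu (A i `\` Z))%E.
  apply: diam_le; first by rewrite mule_ge0.
  have le s t : A i s -> A i t -> 0 <= s -> s <= t -> t <= 1 ->
      ((mdist (g s) (g t))%:E <= K%:E * mu (A i `\` Z))%E.
    move=> As At s0 st t1; apply: le_trans (gK _ _ s0 st t1) _.
    rewrite lee_wpmul2l//; apply: le_measure; rewrite ?inE//; try exact: measurableD.
    apply: setSD => u; rewrite /= in_itv/= => /andP[su ut].
    have [[x y] _ /= Axy] := mA i; move: As At; rewrite -Axy /= !in_itv/= => /andP[? ?] /andP[? ?].
    by apply/andP; split; lra.
  move=> _ _ [s [As +] <-] [t [At +] <-]; rewrite /= !in_itv/= => /andP[s0 s1] /andP[t0 t1].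
  have [st|/ltW ts] := leP s t; first exact: le.
  by rewrite metric_sym; exact: le.
have KcE : (K%:E * c%:E <= (Num.min d e)%:E)%E.
  rewrite -EFinM lee_fin /c mulrA ler_pdivrMr// mulrC ler_wpM2l//.
    by rewrite le_min !ltW.
  by lra.
apply: (@le_trans _ _ (\sum_(0 <= i <oo) diam (F i))%E).
  apply: hausdorff1_preP.
    move=> _ [t Zt <-]; have [i _ At] := ZA _ Zt; exists i => //.
    by exists t => //; split => //; exact: Z01.
  move=> i; apply: le_trans (diamF i) _.
  apply: le_trans (le_trans KcE _); last by rewrite lee_fin ge_min lexx.
  rewrite lee_wpmul2l//; apply: le_trans sumD.
  rewrite (nneseriesD1 (n := i))// leeDl//; apply: nneseries_ge0 => *; exact: measure_ge0.
apply: (@le_trans _ _ (\sum_(0 <= i <oo) K%:E * mu (A i `\` Z))%E).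
  by apply: lee_nneseries => // i _; move=> _; exact: diam_ge0.
rewrite nneseriesZl//; apply: le_trans (lee_wpmul2l _ sumD) _ => //.
by apply: le_trans KcE _; rewrite lee_fin ge_min lexx orbT.
Qed.

End image_null.

(** * A point crossed once with nonzero speed contradicts degree zero *)

Section simple_crossing.
Context {R : realType} {X : metricType R}.
Notation mu := (@lebesgue_measure R).
Variables (g : R -> X) (L : R).
Hypothesis L0 : 0 <= L.
Hypothesis gL : forall t t', mdist (g t) (g t') <= L * `|t' - t|.

Lemma derive1_lower_bound (h : R -> R) (t : R) : derivable h t 1 ->
  derive1 h t != 0 ->
  exists2 r, 0 < r & forall s, `|s - t| < r -> `|derive1 h t| / 2 * `|s - t| <= `|h s - h t|.
Proof.
move=> dh h'0; set a := derive1 h t.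
have a0 : 0 < `|a| by rewrite normr_gt0.
have : (fun k => k^-1 *: ((h \o shift t) (k *: 1) - h t)) @ 0^' --> a.
  by rewrite /a derive1E; exact: dh.
move=> /cvgrPdist_lt/(_ _ (divr_gt0 a0 (ltr0n R 2))).
rewrite near_withinE => /nbhs_ballP[r /= r0 hr].
exists r => // s str; have [->|st] := eqVneq s t.
  by rewrite !subrr normr0 mulr0.
have st0 : s - t != 0 by rewrite subr_eq0.
have := hr (s - t); rewrite /ball/= sub0r normrN => /(_ str st0).
rewrite -[(s - t) *: 1]/((s - t) * 1) mulr1 subrK -[_^-1 *: _]/((s - t)^-1 * _) => h1.
have : `|a| / 2 <= `|(s - t)^-1 * (h s - h t)|.
  have := ler_distD ((s - t)^-1 * (h s - h t)) a 0; rewrite !subr0; lra.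
by rewrite normrM normfV [_^-1 * _]mulrC ler_pdivlMr ?normr_gt0.
Qed.

(** The times of [0, 1] outside the ball form a compact set, whose image is closed and misses
    [x]. *)
Lemma unique_preimage_far (x : X) (t r : R) : 0 < r ->
  (forall s, 0 <= s -> s <= 1 -> g s = x -> s = t) ->
  exists2 e, 0 < e & forall s, 0 <= s -> s <= 1 -> mdist x (g s) < e -> `|s - t| < r.
Proof.
move=> r0 uniq; pose K := `[0, 1]%classic `&` ~` ball t r.
have cK : compact K.
  apply: compact_closedI; first exact: segment_compact.
  by apply: open_closedC; exact: ball_open.
have cgK : closed (g @` K).
  apply: compact_closed; first exact: metric_hausdorff.
  apply: continuous_compact => //; apply: continuous_subspaceT.
  exact: lipschitz_curve_continuous gL.
have : nbhs x (~` (g @` K)).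
  apply: open_nbhs_nbhs; split; first exact: closed_openC.
  move=> [s []]; rewrite /= in_itv/= => /andP[s0 s1] st gs; apply: st.
  by rewrite (uniq s)//; exact: ballxx.
move=> /nbhs_ballP[e /= e0 eK]; exists e => // s s0 s1 xs.
apply: contrapT => st; apply: (eK (g s)); first by rewrite ballEmdist.
exists s => //; split; first by rewrite /= in_itv/= s0.
by rewrite /ball/= distrC.
Qed.

Lemma lebesgue_pt_small (phi : R -> R) (t c : R) : measurable_fun setT phi ->
  0 < c -> lebesgue_pt phi t ->
  exists2 d, 0 < d & forall r, 0 < r -> r < d ->
   (\int[mu]_(s in ball t r) `|phi s - phi t|%:E < (c * r)%:E)%E.
Proof.
move=> mphi c0 pt.
have c2 : 0 < c / 2 by rewrite divr_gt0.
have [d /= d0 dr] : \forall r \near 0^'+, (davg phi t r < (c / 2)%:E)%E.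
  move: pt; rewrite /lebesgue_pt => /fine_cvgP[finr /cvgrPdist_lt /(_ _ c2)].
  move=> h; near=> r; have fr : davg phi t r \is a fin_num by near: r.
  rewrite -(fineK fr) lte_fin (le_lt_trans (ler_norm _))//.
  by near: r; apply: filterS h => r /=; rewrite sub0r normrN.
exists d => // r r0 rd.
have := dr r; rewrite /ball/= sub0r normrN gtr0_norm// => /(_ rd r0).
rewrite /davg /iavg lebesgue_measure_ball ?(ltW r0)//.
have r2 : 0 < r *+ 2 by rewrite mulrn_wgt0.
rewrite inver gt_eqF// lte_pdivrMl//.
by rewrite -EFinM (_ : r *+ 2 * (c / 2) = c * r)//; rewrite -mulr_natr; lra.
Unshelve. all: by end_near. Qed.

(* Test the degree against f = max(0, r - d(x, .)): if t were the only preimage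
   of x, then as r tends to 0 the integral of (f o g) phi would be at least
   |phi t| times the integral of f o g, which is of order r^2, up to o(r^2). *)
Lemma no_simple_crossing (k : X -> R) (phi : R -> R) (t : R) :
  (forall y z, `|k y - k z| <= mdist y z) ->
  measurable_fun setT phi -> (forall s, `|phi s| <= L) ->
  (forall f : X -> R, @lipschitz_map R X R^o setT f ->
     \int[mu]_(s in `[0, 1]) (f (g s) * phi s) = 0) ->
  0 < t -> t < 1 -> lebesgue_pt phi t -> phi t != 0 ->
  derivable (k \o g) t 1 -> derive1 (k \o g) t = phi t ->
  exists2 s, s \in `[0, 1] & g s = g t /\ s != t.
Proof.
move=> k1 mphi phiL deg t0 t1 pt phit dk k't.
apply: contrapT => nos.
have uniq s : 0 <= s -> s <= 1 -> g s = g t -> s = t.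
  move=> s0 s1 gs; apply: contrapT => /eqP st; apply: nos; exists s => //.
  by rewrite in_itv/= s0.
set x := g t in uniq *; set a := `|phi t|.
have a0 : 0 < a by rewrite normr_gt0.
have [r1 r10 kr] : exists2 r, 0 < r & forall s, `|s - t| < r ->
    a / 2 * `|s - t| <= mdist x (g s).
  have [|r r0 hr] := derive1_lower_bound dk; first by rewrite k't.
  exists r => // s st; rewrite /a -k't (le_trans (hr s st))//.
  by rewrite metric_sym; exact: k1.
have [e e0 far] := unique_preimage_far r10 uniq.
pose L1 := L + 1; have L10 : 0 < L1 by rewrite ltr_wpDl.
(* Chosen so that the upper bound r c q and the lower bound a (r/2)(r/L1) obtained below are equal;
   the strict inequality of [smallq] then gives the contradiction. *)
pose c := a ^+ 2 / (4 * L1).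
have c0 : 0 < c by rewrite divr_gt0 ?exprn_gt0 ?mulr_gt0.
have [d d0 small] := lebesgue_pt_small mphi c0 pt.
have [r [r0 re rd rt]] : exists r, [/\ 0 < r, r < e, 2 * r / a < d &
    2 * r / a < Num.min t (1 - t)].
  pose m := Num.min (Num.min e (d * (a / 2))) (Num.min t (1 - t) * (a / 2)).
  have m0 : 0 < m.
    have a20 : 0 < a / 2 by rewrite divr_gt0.
    rewrite !lt_min e0 (mulr_gt0 d0 a20) /= mulr_gt0// lt_min t0; lra.
  have m2 : m / 2 < m by lra.
  have scale y z : z / 2 < y * (a / 2) -> 2 * (z / 2) / a < y.
    by rewrite [y * _]mulrA ltr_pM2r// ltr_pdivrMr// [2 * _]mulrC divfK.
  exists (m / 2); split; [lra| |apply: scale|apply: scale];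
    apply: lt_le_trans m2 _; rewrite /m !ge_min lexx ?orbT//.
(* Where the bump is nonzero at g s, this point is within [r] of [x]; then [s] is near [t], and the
   slope bound a/2 forces |s - t| < q. *)
pose q := 2 * r / a.
have q0 : 0 < q by rewrite divr_gt0// mulr_gt0.
pose f y := Num.max 0 (r - mdist x y).
have f1 y z : `|f y - f z| <= mdist y z.
  have := mdist_dist x y z; rewrite /f !ler_norml => /andP[].
  by case: (leP 0 (r - mdist x y)); case: (leP 0 (r - mdist x z)) => *;
    apply/andP; split; have := mdist_ge0 y z; lra.
have fr y : 0 <= f y <= r.
  rewrite /f le_max lexx/= ge_max ltW//=; have := mdist_ge0 x y; lra.
have deg0 : \int[mu]_(s in `[0, 1]) (f (g s) * phi s) = 0.
  by apply: deg; exists 1 => y z _ _; rewrite mul1r /mdist/= distrC.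
have fball s : 0 <= s -> s <= 1 -> f (g s) != 0 -> `|s - t| < q.
  move=> s0 s1; rewrite /f; case: (leP 0 (r - mdist x (g s))); last by rewrite eqxx.
  rewrite le_eqVlt => /orP[/eqP <-|]; first by rewrite eqxx.
  rewrite subr_gt0 => xs _; have := kr s (far s s0 s1 (lt_trans xs re)).
  rewrite /q ltr_pdivlMr// => h; move: xs h; move: (mdist _ _) `|s - t| => y z.
  by rewrite [a / 2 * z]mulrC [z * (a / 2)]mulrA; lra.
pose u s := f (g s); pose w s := `|phi s - phi t|.
have mu_ : measurable_fun setT u.
  apply: (@lipschitz_measurable _ u (1 * L)).
  by apply: lipschitz_comp => // y z; rewrite mul1r.
have mw : measurable_fun setT w.
  by apply: measurableT_comp => //; exact: measurable_funB.
have wL s : w s <= 2 * L.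
  by apply: le_trans (ler_normB _ _) _; have := phiL s; have := phiL t; lra.
have ur s : 0 <= u s <= r := fr (g s).
pose I := `[0, 1]%classic : set (measurableTypeR R).
have mI : measurable I by exact: measurable_itv.
have int (v : R -> R) (M : R) : measurable_fun setT v -> (forall s, `|v s| <= M) ->
    mu.-integrable I (EFin \o v).
  move=> mv vM; apply: (@bounded_itv_integrable _ _ _ M) => //.
  exact: lebesgue_measure_itv_lty.
have u_r s : `|u s| <= r by have /andP[? ?] := ur s; rewrite ger0_norm.
have iu : mu.-integrable I (EFin \o u) by exact: int u_r.
have iuphi : mu.-integrable I (EFin \o (fun s => u s * phi s)).
  apply: (int _ (r * L)); first exact: measurable_funM.
  by move=> s; rewrite normrM ler_pM.
have itu : mu.-integrable I (EFin \o (fun s => phi t * u s)).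
  apply: (int _ (L * r)).
    by apply: measurable_funM => //; exact: measurable_cst.
  by move=> s; rewrite normrM ler_pM.
have tI : Num.min t (1 - t) <= t /\ Num.min t (1 - t) <= 1 - t.
  by rewrite !ge_min !lexx orbT.
have ballI y : y <= q -> ball t y `<=` I.
  move=> yq s; rewrite /ball/= /I /= in_itv/= ltr_norml => /andP[h1 h2].
  by move: rt tI; rewrite -/q => rt [tI1 tI2]; apply/andP; split; lra.
(* As the integral of u phi is 0, a times the integral of [u] equals the absolute integral of u (phi
   t - phi), which lives on the ball of radius [q], where u <= r. *)
have upper : a * \int[mu]_(s in I) u s <= r * \int[mu]_(s in ball t q) w s.
  have mB : measurable (ball t q : set (measurableTypeR R)) by exact: measurable_ball.
  have -> : a * \int[mu]_(s in I) u s =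
      `|\int[mu]_(s in I) (phi t * u s - u s * phi s)|.
    rewrite RintegralB// RintegralZl// deg0 subr0 normrM; congr (_ * _).
    by rewrite ger0_norm// Rintegral_ge0// => s _; have /andP[] := ur s.
  have idiff : mu.-integrable I (EFin \o (fun s => phi t * u s - u s * phi s)).
    apply: (int _ (L * r + r * L)).
      apply: measurable_funB; last exact: measurable_funM.
      by apply: measurable_funM => //; exact: measurable_cst.
    move=> s; apply: le_trans (ler_normB _ _) _.
    by apply: lerD; rewrite normrM ler_pM.
  apply: le_trans (le_normr_Rintegral mI idiff) _.
  have -> : r * \int[mu]_(s in ball t q) w s = \int[mu]_(s in I) (r * (w \_ (ball t q)) s).
    have iwB : mu.-integrable I (EFin \o (w \_ (ball t q))).
      apply: (int _ (2 * L)).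
        by apply/(measurable_restrictT _ _).1 => //; exact: measurable_funTS.
      move=> s; rewrite /patch; case: ifP => _; last by rewrite normr0 mulr_ge0.
      by rewrite ger0_norm// normr_ge0.
    rewrite RintegralZl//; congr (_ * _); rewrite -Rintegral_mkcondr.
    by rewrite setIC setIidl//; exact: ballI.
  apply: le_Rintegral => //.
  - apply: (int _ (L * r + r * L)).
      apply: measurableT_comp => //; apply: measurable_funB; last exact: measurable_funM.
      by apply: measurable_funM => //; exact: measurable_cst.
    move=> s; rewrite normr_id; apply: le_trans (ler_normB _ _) _.
    by apply: lerD; rewrite normrM ler_pM.
  - apply: (int _ (r * (2 * L))).
      apply: measurable_funM; first exact: measurable_cst.
      by apply/(measurable_restrictT _ _).1 => //; exact: measurable_funTS.
    move=> s; rewrite normrM ger0_norm ?(ltW r0)// ler_wpM2l ?(ltW r0)//.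
    rewrite /patch; case: ifP => _; last by rewrite normr0 mulr_ge0.
    by rewrite ger0_norm// normr_ge0.
  - move=> s; rewrite /I /= in_itv/= => /andP[s0 s1].
    have -> : phi t * u s - u s * phi s = - (u s * (phi s - phi t)) by ring.
    rewrite normrN normrM -/(w s); have [us0|us0] := eqVneq (u s) 0.
      rewrite us0 normr0 mul0r mulr_ge0 ?(ltW r0)// /patch.
      by case: ifP => // _; exact: normr_ge0.
    rewrite /patch mem_set; last by rewrite /ball/= distrC; exact: fball.
    by rewrite ler_wpM2r// normr_ge0.
(* On the ball of radius r/(2 L1) around [t] the Lipschitz bound keeps g s within r/2 of [x], so
   there u >= r/2. *)
have lower : r / 2 * (r / L1) <= \int[mu]_(s in I) u s.
  pose b := r / (2 * L1); have b0 : 0 < b by rewrite divr_gt0 ?mulr_gt0.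
  have mb : measurable (ball t b : set (measurableTypeR R)) by exact: measurable_ball.
  have bq : b <= q.
    have aL1 : a <= L1 by have := phiL t; rewrite -/a /L1; lra.
    rewrite /b /q ler_pdivrMr ?mulr_gt0// mulrAC ler_pdivlMr//.
    have := ler_wpM2l (ltW r0) aL1; have := mulr_gt0 r0 L10; lra.
  have <- : \int[mu]_(s in I) (r / 2 * \1_(ball t b) s) = r / 2 * (r / L1).
    rewrite RintegralZl//; last first.
      apply: (int _ 1); first exact: measurable_indic.
      by move=> s; rewrite indicE; case: (_ \in _); rewrite ?normr1 ?normr0.
    congr (_ * _); rewrite /Rintegral integral_indic// setIidl; last exact: ballI.
    rewrite -[fine _]/(fine (mu (ball t b))) lebesgue_measure_ball ?(ltW b0)//=.
    by rewrite /b -mulr_natr; field; rewrite gt_eqF.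
  apply: le_Rintegral => //.
  - apply: (int _ (r / 2 * 1)).
      apply: measurable_funM; first exact: measurable_cst.
      exact: measurable_indic.
    move=> s; rewrite normrM indicE ger0_norm ?divr_ge0 ?(ltW r0)//.
    rewrite ler_wpM2l ?divr_ge0 ?(ltW r0)//.
    by case: (_ \in _); rewrite ?normr1 ?normr0.
  - move=> s _; rewrite indicE; have [/set_mem sb|_] := boolP (s \in _); last first.
      by rewrite mulr0; have /andP[] := ur s.
    rewrite mulr1 /u /f le_max; apply/orP; right.
    suff : mdist x (g s) <= r / 2 by lra.
    apply: le_trans (gL _ _) _; move: sb; rewrite /ball/= distrC => sb.
    apply: (@le_trans _ _ (L1 * b)); first by rewrite ler_pM// ?lerDl// ltW.
    have -> // : L1 * b = r / 2.
    by rewrite /b; field; rewrite gt_eqF.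
have smallq : \int[mu]_(s in ball t q) w s < c * q.
  have wq := small q q0 rd; rewrite -lte_fin /Rintegral fineK//.
  rewrite ge0_fin_numE; first exact: lt_trans wq (ltry _).
  by apply: integral_ge0 => s _; rewrite lee_fin normr_ge0.
have cE : r * (c * q) = a * (r / 2 * (r / L1)).
  by rewrite /c /q; field; rewrite !gt_eqF.
have := le_lt_trans (le_trans (ler_wpM2l (ltW a0) lower) upper)
  (_ : _ < r * (c * q)).
by rewrite ltr_pM2l// cE ltxx => /(_ smallq).
Qed.

End simple_crossing.

Section multiple_points.
Context {R : realType} {X : metricType R}.
Notation mu := (@lebesgue_measure R).
Variables (g : R -> X) (L : R).
Hypothesis L0 : 0 <= L.
Hypothesis gL : forall t t', mdist (g t) (g t') <= L * `|t' - t|.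
Hypothesis traps : forall (f h : X -> R) (F G : R) (K : nat),
  (forall x y, `|f x - f y| <= F * mdist x y) ->
  (forall x y, `|h x - h y| <= G * mdist x y) -> 0 <= F -> 0 <= G ->
  `|\sum_(i < K.+1) trap f h (g (i%:R / K.+1%:R)) (g (i.+1%:R / K.+1%:R))|
    <= 2 * F * G * L ^+ 2 / K.+1%:R.

Lemma lebesgue_pt_null (phi : R -> R) (M : R) : measurable_fun setT phi ->
  (forall t, `|phi t| <= M) -> exists N : set (measurableTypeR R),
  [/\ measurable N, mu N = 0%E & forall t, ~ N t -> lebesgue_pt phi t].
Proof.
move=> mphi phiM.
have [N [mN N0 subN]] := lebesgue_differentiation (locally_integrable_bounded mphi phiM).
by exists N; split => // t Nt; apply: contrapT => npt; apply: Nt; exact: subN.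
Qed.

Lemma traps_degree_zero : degree_zero 0 1 g.
Proof.
move=> f k fL kL; have [G G0 kG] := lipschitz_mapP kL.
have [phi [mphi phiP kphi dphi]] :=
  lipschitz_density (mulr_ge0 G0 L0) (lipschitz_comp gL G0 kG).
have [N [mN N0 Npt]] := lebesgue_pt_null mphi phiP.
rewrite -[RHS](degree_zeroP L0 gL traps fL kL mphi (ex_intro _ _ phiP) kphi).
rewrite /path_integral /Rintegral; congr fine.
(* The endpoints join the null set, because the derivative is identified with the density only
   inside ]0, 1[. *)
have m01 : measurable ([set 0; 1] : set (measurableTypeR R)).
  by apply: measurableU; exact: measurable_set1.
have n01 : mu [set 0; 1] = 0%E.
  exact/countable_lebesgue_measure0/finite_set_countable.
pose N' := N `|` [set 0; 1].
apply: (@eq_integral_off_null _ _ _ _ _ N').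
- exact: measurableU.
- by rewrite measureU0.
move=> t; rewrite /= in_itv/= => /andP[t0 t1] Nt.
have [||_ ->] := dphi t _ _ (Npt t (fun Nt' => Nt (or_introl Nt'))) => //.
- by rewrite lt_neqAle t0 andbT; apply/eqP => t0'; apply: Nt; right; left.
- by rewrite lt_neqAle t1 andbT; apply/eqP => t1'; apply: Nt; right; right.
Qed.

Lemma multiple_points : compact [set: X] -> exists E : set X,
  hausdorff1 E = 0%E /\ forall t, 0 < t -> t < 1 -> ~ E (g t) ->
    exists2 s, s \in `[0, 1] & g s = g t /\ s != t.
Proof.
move=> cX; have [xs xsP] := compact_dense_sequence (g 0) cX.
have k1 i : forall x y, `|mdist (xs i) x - mdist (xs i) y| <= 1 * mdist x y.
  by move=> x y; rewrite mul1r; exact: mdist_dist.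
have /choice[phi phiP] (i : nat) := lipschitz_density
  (mulr_ge0 (@ler01 R) L0) (lipschitz_comp gL ler01 (k1 i)).
have mphi i : measurable_fun setT (phi i) by have [] := phiP i.
have phiL i t : `|phi i t| <= L by have [_ + _ _] := phiP i; rewrite mul1r.
have /choice[N NP] (i : nat) := lebesgue_pt_null (mphi i) (phiL i).
pose J : set (measurableTypeR R) := `[0, 1]%classic.
have mJ : measurable J by exact: measurable_itv.
(* Exceptional times: outside them every [phi i] has a Lebesgue point. They are null, and so is
   their image, [g] being Lipschitz. *)
pose NN : set (measurableTypeR R) := J `&` \bigcup_i N i.
have mNN : measurable NN.
  by apply: measurableI => //; apply: bigcup_measurable => i _; have [] := NP i.
have NN0 : mu NN = 0%E.
  apply/eqP; rewrite eq_le measure_ge0 andbT.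
  apply: (@le_trans _ _ (\sum_(0 <= i <oo) mu (N i))%E).
    apply: measure_sigma_subadditive => //; first by move=> i; have [] := NP i.
    by move=> t [].
  by rewrite eseries0// => i _ _; have [] := NP i.
(* Times at which all densities vanish. This set may have positive measure, but distances along [g]
   grow only outside it. *)
pose Z : set (measurableTypeR R) := J `&` \bigcap_i (phi i @^-1` [set 0]).
have mZ : measurable Z.
  apply: measurableI => //; apply: bigcap_measurable => // i _.
  by rewrite -[X in measurable X]setTI; apply: mphi => //; exact: measurable_set1.
exists (g @` NN `|` g @` Z); split.
  apply/eqP; rewrite eq_le hausdorff1_ge0 andbT.
  apply: le_trans (outer_measureU2 _ _ _) _ => /=.
  rewrite (hausdorff1_image_null L0 mNN)//.
  - rewrite (hausdorff1_image_null L0 mZ) ?adde0//; first by move=> t [].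
    move=> a b a0 ab b1.
    pose ab' : set (measurableTypeR R) := `[a, b]%classic.
    have mab : measurable ab' by exact: measurable_itv.
    have mD : measurable (ab' `\` Z) by exact: measurableD.
    have Dfin : mu (ab' `\` Z) \is a fin_num.
      rewrite ge0_fin_numE//.
      apply: le_lt_trans (lebesgue_measure_itv_lty a b true false).
      by apply: le_measure; rewrite ?inE.
    rewrite -(fineK Dfin) -EFinM lee_fin; apply/ler_addgt0Pr => e e0.
    (* For [xs i] within e/2 of g a, the change of the distance to [xs i] between g a and g b
       recovers the distance of these two points up to [e]. *)
    have [i gai] := xsP (g a) (e / 2) (divr_gt0 e0 (ltr0n R 2)).
    suff : `|mdist (xs i) (g b) - mdist (xs i) (g a)| <= L * fine (mu (ab' `\` Z)).
      have := metric_triangle (g a) (xs i) (g b); move: gai.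
      rewrite (metric_sym (g a) (xs i)) ler_norml => h1 h2 /andP[_ h3]; lra.
    rewrite -lee_fin EFinM fineK//.
    have [_ _ /(_ a b a0 ab b1) kphi _] := phiP i.
    rewrite -[(`|_|)%:E]/(`|(_ - _)%:E|)%E kphi.
    have mp : measurable_fun ab' (EFin \o phi i).
      by apply/measurable_EFinP; exact: measurable_funTS (mphi i).
    apply: le_trans (le_abse_integral _ mab mp) _.
    have -> : (\int[mu]_(t in ab') `|(EFin \o phi i) t| =
        \int[mu]_(t in ab' `&` ~` Z) `|(EFin \o phi i) t|)%E.
      rewrite integral_mkcondr; apply: eq_integral => t /set_mem tab.
      rewrite /patch; case: ifPn => // /negP tZ.
      have [_ /(_ i I) /= ->] : Z t by apply: contrapT => nZ; apply: tZ; rewrite inE.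
      by rewrite normr0.
    rewrite -integral_cst//; apply: ge0_le_integral => //.
    + apply: measurableT_comp => //; apply/measurable_EFinP.
      exact: measurable_funTS (mphi i).
    + by move=> t _; rewrite lee_fin.
  - by move=> t [].
  - move=> a b a0 ab b1.
    have -> : mu (`[a, b] `\` NN) = (b - a)%:E.
      have mab : measurable (`[a, b]%classic : set (measurableTypeR R)).
        exact: measurable_itv.
      transitivity (mu `[a, b]%classic).
        rewrite (measureDI _ mab mNN) [X in (_ + X)%E](_ : _ = 0%E) ?adde0//.
        apply/eqP; rewrite eq_le measure_ge0 andbT -NN0.
        by apply: le_measure; rewrite ?inE//; exact: measurableI.
      by rewrite lebesgue_measure_itv/= lte_fin; case: ltP => // ba; congr EFin; lra.
    by rewrite -EFinM lee_fin (le_trans (gL a b))// ger0_norm ?subr_ge0.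
move=> t t0 t1 /not_orP[nN nZ].
have Jt : J t by rewrite /J /= in_itv/= !ltW.
have [i phit] : exists i, phi i t != 0.
  apply: contrapT => /forallNP h; apply: nZ; exists t => //; split => // i _ /=.
  by apply: contrapT => /eqP; exact: h.
have pt : lebesgue_pt (phi i) t.
  have [_ _] := NP i; apply => Nt; apply: nN; exists t => //; split => //.
  by exists i.
have [_ _ kphi /(_ t t0 t1 pt)[dk k't]] := phiP i.
apply: (@no_simple_crossing R X g L L0 gL (mdist (xs i)) (phi i)) => //.
  exact: mdist_dist.
move=> f fL; apply: (degree_zeroP L0 gL traps fL (k := mdist (xs i))) => //.
  by exists 1 => x y _ _; rewrite /mdist/= distrC; exact: k1.
by exists L.
Qed.

End multiple_points.

(** * Length and multiplicity *)

Section path_length.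
Context {R : realType} {X : metricType R}.
Variables (g : R -> X) (L : R).
Hypothesis L0 : 0 <= L.
Hypothesis gL : forall t t', mdist (g t) (g t') <= L * `|t' - t|.
Implicit Types a b c : R.

Lemma mdist_le_path_length a b s t : a <= s -> s <= t -> t <= b ->
  ((mdist (g s) (g t))%:E <= path_length a b g)%E.
Proof.
move=> a_s st tb; apply: ereal_sup_ubound.
exists 1%N, (fun i => if i is 0%N then s else t); split => //.
- by move=> [|[|]]//= _; rewrite in_itv/=; apply/andP; split; lra.
- by case.
- by rewrite big_ord_recl big_ord0 addr0.
Qed.

Lemma path_length_le a b : a <= b -> (path_length a b g <= (L * (b - a))%:E)%E.
Proof.
move=> ab; apply: ge_ereal_sup => _ [n [t [n0 tab tS ->]]]; rewrite lee_fin.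
apply: (@le_trans _ _ (\sum_(i < n) (L * (t i.+1 - t i)))).
  apply: ler_sum => i _; apply: le_trans (gL _ _) _.
  by rewrite ger0_norm// subr_ge0 tS.
rewrite -mulr_sumr ler_wpM2l//.
rewrite -(big_mkord xpredT (fun i => t i.+1 - t i)) telescope_sumr//.
have := tab n (leqnn n); have := tab 0%N (leq0n n); rewrite !in_itv/= => /andP[? ?] /andP[? ?].
by apply: lerB.
Qed.

Lemma path_length_ge0 a b : a <= b -> (0 <= path_length a b g)%E.
Proof.
move=> ab; apply: le_trans (mdist_le_path_length (lexx a) (lexx a) ab).
by rewrite mdistxx.
Qed.

Lemma path_length_fin_num a b : a <= b -> path_length a b g \is a fin_num.
Proof.
move=> ab; rewrite ge0_fin_numE; first exact: le_lt_trans (path_length_le ab) (ltry _).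
exact: path_length_ge0.
Qed.

Lemma path_length_cat a b c : a <= b -> b <= c ->
  (path_length a b g + path_length b c g <= path_length a c g)%E.
Proof.
move=> ab bc; have ac := le_trans ab bc.
rewrite -leeBrDr ?path_length_fin_num//.
apply: ge_ereal_sup => _ [n [s [n0 sab sS ->]]].
rewrite leeBrDr ?path_length_fin_num// addeC -leeBrDr//.
apply: ge_ereal_sup => _ [m [t [m0 tbc tS ->]]].
rewrite leeBrDr// -EFinD.
(* The second partition starts at index [n.+1], so the glued one has an extra edge from s n to t 0;
   its length is nonnegative and is dropped. *)
pose u i := if (i <= n)%N then s i else t (i - n.+1)%N.
have uP : ((\sum_(i < n + m.+1) mdist (g (u i)) (g (u i.+1)))%:E <= path_length a c g)%E.
  apply: ereal_sup_ubound; exists (n + m.+1)%N, u; split => //.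
  - by rewrite addnS.
  - move=> i im; rewrite /u; case: leqP => ni.
      by have := sab _ ni; rewrite !in_itv/= => /andP[? ?]; apply/andP; split; lra.
    have := tbc (i - n.+1)%N; rewrite !in_itv/= => /(_ ltac:(lia))/andP[? ?].
    by apply/andP; split; lra.
  - move=> i im; rewrite /u; case: (ltngtP i n) => ni.
    + exact: sS.
    + by rewrite subSn//; apply: tS; lia.
    + rewrite ni subnn.
      have := sab n (leqnn n); have := tbc 0%N (leq0n m).
      by rewrite !in_itv/= => /andP[? ?] /andP[? ?]; lra.
apply: le_trans uP; rewrite lee_fin big_split_ord/= [leLHS]addrC.
apply: lerD.
  rewrite le_eqVlt; apply/orP; left; apply/eqP/eq_bigr => i _.
  by rewrite /u (ltnW (ltn_ord i)) ltn_ord.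
rewrite big_ord_recl/= ler_wpDl ?mdist_ge0//.
rewrite le_eqVlt; apply/orP; left; apply/eqP/eq_bigr => i _.
have uE j : u (n + j.+1)%N = t j by rewrite /u addnS leqNgt ltnS leq_addr/= subSS addKn.
have -> : bump 0 i = i.+1 by [].
by rewrite -addnS !uE.
Qed.

Lemma path_length_partition (p : nat -> R) n : (forall i, p i <= p i.+1) ->
  (\sum_(0 <= i < n) path_length (p i) (p i.+1) g <= path_length (p 0%N) (p n) g)%E.
Proof.
move=> pS; have p0 i : p 0%N <= p i.
  by elim: i => // i IH; exact: le_trans IH (pS i).
elim: n => [|n IH].
  by rewrite big_geq// path_length_ge0.
rewrite big_nat_recr//=; apply: le_trans (leeD2r _ IH) _.
exact: path_length_cat.
Qed.

Definition subdivision a b n (i : nat) : R := a + (b - a) * (i%:R / n.+1%:R).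

Lemma subdivision0 a b n : subdivision a b n 0 = a.
Proof. by rewrite /subdivision mul0r mulr0 addr0. Qed.

Lemma subdivision_last a b n : subdivision a b n n.+1 = b.
Proof. by rewrite /subdivision divff ?gt_eqF// mulr1 addrC subrK. Qed.

Lemma subdivisionS a b n i :
  subdivision a b n i.+1 - subdivision a b n i = (b - a) / n.+1%:R.
Proof. by rewrite /subdivision -natr1; field; rewrite gt_eqF ?ltr0n. Qed.

Lemma subdivision_le a b n i : a <= b ->
  subdivision a b n i <= subdivision a b n i.+1.
Proof. by move=> ab; rewrite -subr_ge0 subdivisionS divr_ge0// subr_ge0. Qed.

Lemma diam_arc_le a b : a <= b ->
  (diam (g @` `[a, b]) <= path_length a b g)%E.
Proof.
move=> ab; apply: diam_le; first exact: path_length_ge0.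
move=> _ _ [s + <-] [t + <-]; rewrite /= !in_itv/= => /andP[a_s sb] /andP[a_t tb].
have [st|/ltW ts] := leP s t; first exact: mdist_le_path_length.
by rewrite metric_sym; exact: mdist_le_path_length.
Qed.

Lemma hausdorff1_arc_le a b : a <= b ->
  (hausdorff1 (g @` `[a, b[) <= path_length a b g)%E.
Proof.
move=> ab; apply: hausdorff1_le => d d0.
pose n := Num.truncn (L * (b - a) / d).
have n0 : 0 < n.+1%:R :> R by rewrite ltr0n.
have nd : L * ((b - a) / n.+1%:R) <= d.
  rewrite mulrA ler_pdivrMr// [d * _]mulrC -ler_pdivrMr//.
  exact/ltW/truncnS_gt.
pose p := subdivision a b n.
have pS i : p i <= p i.+1 := subdivision_le n i ab.
pose F i := if (i < n.+1)%N then g @` `[p i, p i.+1] else set0.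
apply: (@le_trans _ _ (\sum_(0 <= i <oo) diam (F i))%E).
  apply: hausdorff1_preP.
    move=> _ [t + <-]; rewrite /= in_itv/= => /andP[a_t tb].
    have piece k : t <= p k.+1 -> exists2 i, (i < k.+1)%N & p i <= t <= p i.+1.
      elim: k => [|k IH] tk; first by exists 0%N => //; rewrite tk /p subdivision0 a_t.
      have [/IH[i ik ti]|/ltW kt] := leP t (p k.+1).
        by exists i => //; exact: ltnW.
      by exists k.+1 => //; rewrite kt tk.
    have [|i iK pt] := piece n; first by rewrite /p subdivision_last ltW.
    by exists i => //; rewrite /F iK; exists t.
  move=> i; rewrite /F; case: ifP => _; last by rewrite diam0 lee_fin ltW.
  apply: le_trans (diam_arc_le (pS i)) _; apply: le_trans (path_length_le (pS i)) _.
  by rewrite lee_fin subdivisionS.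
rewrite (nneseries_split 0 n.+1)//; last by move=> *; exact: diam_ge0.
rewrite add0n eseries0 ?adde0; last first.
  by move=> i ni _; rewrite /F ltnNge ni /= diam0.
have := path_length_partition n.+1 pS.
rewrite (subdivision0 a b n : p 0%N = a).
rewrite (subdivision_last a b n : p n.+1 = b).
apply: le_trans; rewrite !big_mkord; apply: lee_sum => i _; rewrite /F ltn_ord.
exact: diam_arc_le.
Qed.

End path_length.

(** * Counting the arcs through a point *)

Section counting_hits.
Context {R : realType} {X : metricType R}.
Local Notation H1 := (@hausdorff1 R X).
Local Notation cara := (caratheodory_measurable H1).
Implicit Types (A B : set X) (s : seq (set X)) (x : X).

Definition hits s x : nat := count (fun A => `[< A x >]) s.

Definition hit_atleast j s : set X := [set x | (j <= hits s x)%N].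

Lemma hit_atleast0 s : hit_atleast 0 s = setT.
Proof. by apply/seteqP; split. Qed.

Lemma hit_atleast_nil j : hit_atleast j.+1 [::] = set0.
Proof. by apply/seteqP; split. Qed.

Lemma hit_atleast_cons j A s :
  hit_atleast j.+1 (A :: s) = hit_atleast j.+1 s `|` (A `&` hit_atleast j s).
Proof.
apply/seteqP; split => x; rewrite /hit_atleast /hits /=.
  case: asboolP => Ax; rewrite ?add0n; last by left.
  by rewrite add1n ltnS => jx; right.
move=> [jx|[Ax jx]]; first by rewrite (leq_trans jx)// leq_addl.
by rewrite asboolT// add1n ltnS.
Qed.

Lemma hit_atleastS j s : hit_atleast j.+1 s `<=` hit_atleast j s.
Proof. by move=> x; exact: ltnW. Qed.

Lemma caratheodory_hit_atleast j s : (forall A, A \in s -> cara A) ->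
  cara (hit_atleast j s).
Proof.
elim: s j => [|A s IH] [|j] cs; rewrite ?hit_atleast0 ?hit_atleast_nil.
- by rewrite -setC0; apply: caratheodory_measurable_setC; exact: caratheodory_measurable_set0.
- exact: caratheodory_measurable_set0.
- by rewrite -setC0; apply: caratheodory_measurable_setC; exact: caratheodory_measurable_set0.
have cs' B : B \in s -> cara B by move=> Bs; apply: cs; rewrite inE Bs orbT.
rewrite hit_atleast_cons; apply: caratheodory_measurable_setU; first exact: IH.
apply: caratheodory_measurable_setI; last exact: IH.
by apply: cs; exact: mem_head.
Qed.

(** Discrete layer-cake formula: a point in exactly m sets of [s] lies in the layers 1, ..., m.
    Adding a set [A] moves the part of [A] in layer [j] but not in layer [j.+1] up by one layer, and
    these parts of [A] are disjoint. *)
Lemma sum_hit_atleast n s : (forall A, A \in s -> cara A) ->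
  (\sum_(j < n) H1 (hit_atleast j.+1 s) <= \sum_(A <- s) H1 A)%E.
Proof.
elim: s => [|A s IH] cs.
  by rewrite big_nil big1// => j _; rewrite hit_atleast_nil hausdorff1_0.
have cs' B : B \in s -> cara B by move=> Bs; apply: cs; rewrite inE Bs orbT.
rewrite big_cons.
apply: (@le_trans _ _ (\sum_(j < n) H1 (hit_atleast j.+1 s) +
    \sum_(j < n) H1 ((A `&` hit_atleast j s) `&` ~` hit_atleast j.+1 s))%E).
  rewrite -big_split/=; apply: lee_sum => j _.
  apply: le_trans (outer_measureU2 _ _ _) => /=.
  apply: le_hausdorff1; rewrite hit_atleast_cons => x [jx|Ajx]; first by left.
  by have [jx|jx] := pselect (hit_atleast j.+1 s x); [left|right].
rewrite addeC leeD//; last exact: IH.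
(* The extra term for the part of [A] not yet split off is what allows the induction on [n]. *)
suff: (\sum_(j < n) H1 ((A `&` hit_atleast j s) `&` ~` hit_atleast j.+1 s) +
    H1 (A `&` hit_atleast n s) <= H1 A)%E.
  by apply: le_trans; rewrite leeDl// hausdorff1_ge0.
elim: n {IH} => [|n IH]; first by rewrite big_ord0 add0e le_hausdorff1.
apply: le_trans IH; rewrite big_ord_recr/= -addeA leeD2l//.
rewrite [leRHS](caratheodory_hit_atleast n.+1 cs') addeC leeD2r//.
by apply: le_hausdorff1 => x [Ax nx]; split => //; split => //; exact: hit_atleastS.
Qed.

Definition arcs (g : R -> X) (p : nat -> R) n : seq (set X) :=
  mkseq (fun i => g @` `[p i, p i.+1[) n.

Lemma caratheodory_arcs (g : R -> X) (p : nat -> R) n A : continuous g ->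
  A \in arcs g p n -> cara A.
Proof. by move=> cg /mapP[i _ ->]; exact: caratheodory_arc. Qed.

(** A time interval shorter than the gap [e] contains at most one of the listed times, so distinct
    times are charged to distinct arcs. *)
Lemma count_le_hits (g : R -> X) (p : nat -> R) n (ss : seq R) x (e : R) :
  (forall i, p i <= p i.+1) -> (forall i, p i.+1 - p i < e) ->
  uniq ss -> (forall t, t \in ss -> g t = x) ->
  (forall t t', t \in ss -> t' \in ss -> t < t' -> e <= t' - t) ->
  (count (fun t => (p 0%N <= t) && (t < p n))%R ss <= hits (arcs g p n) x)%N.
Proof.
move=> pS pe us sx sep; have p0 i : p 0%N <= p i.
  by elim: i => // i IH; exact: le_trans IH (pS i).
elim: n => [|n IH].
  rewrite (eq_count (a2 := pred0)) ?count_pred0// => t /=.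
  by apply/negbTE; rewrite negb_and -leNgt -ltNge; case: ltP => // ->; rewrite ?orbT.
rewrite /arcs mkseqS -cats1 /hits count_cat -/(arcs _ _ _) -/(hits _ _).
have -> : count (fun t => (p 0%N <= t) && (t < p n.+1)) ss =
  (count (fun t => (p 0%N <= t) && (t < p n))%R ss +
   count (fun t => (p n <= t) && (t < p n.+1))%R ss)%N.
  rewrite -count_predUI [X in (_ + X)%N](_ : _ = 0%N); last first.
    rewrite (eq_count (a2 := pred0)) ?count_pred0// => t /=.
    by apply/negbTE/negP => /andP[/andP[_ h1] /andP[h2 _]]; lra.
  rewrite addn0; apply: eq_count => t /=.
  have := p0 n; have := pS n; case: (leP (p n) t) => /= h1 h2 h3.
    by rewrite (le_trans h3 h1).
  by rewrite (lt_le_trans h1 h2) ?andbT ?orbF.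
apply: leq_add => //=; rewrite addn0.
set a := fun t => _; have [|] := leqP (count a ss) 0; first by move/leq_trans; apply.
rewrite -has_count => /hasP[t ts at_]; rewrite asboolT; last first.
  by exists t; [rewrite /= in_itv|exact: sx].
rewrite -size_filter; apply: (uniq_leq_size (s2 := [:: t])).
  exact: filter_uniq.
move=> t'; rewrite mem_filter inE => /andP[/andP[h1 h2] ts'].
move: at_ => /andP[h3 h4]; have h5 := pe n; apply: contraT => tt'.
have /orP[lt|lt] : (t' < t) || (t < t') by rewrite -neq_lt.
  by have := sep _ _ ts' ts lt; lra.
by have := sep _ _ ts ts' lt; lra.
Qed.

End counting_hits.

Lemma uniq_gap (R : realType) (ss : seq R) : exists2 e : R, 0 < e &
  forall t t', t \in ss -> t' \in ss -> t < t' -> e <= t' - t.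
Proof.
have far (a : R) (s : seq R) : exists2 e : R, 0 < e &
    forall t, t \in s -> t != a -> e <= `|t - a|.
  elim: s => [|b s [e e0 es]]; first by exists 1.
  have [ba|ba] := eqVneq b a.
    by exists e => // t; rewrite inE => /orP[/eqP ->|/es//]; rewrite ba eqxx.
  exists (Num.min e `|b - a|); first by rewrite lt_min e0 normr_gt0 subr_eq0.
  move=> t; rewrite inE ge_min => /orP[/eqP -> _|ts ta]; first by rewrite lexx orbT.
  by rewrite es.
elim: ss => [|a s [e e0 es]]; first by exists 1.
have [e' e'0 es'] := far a s; exists (Num.min e e'); first by rewrite lt_min e0.
move=> t t'; rewrite !inE ge_min => /orP[/eqP ->|ts] /orP[/eqP ->|ts'] tt'.
- by rewrite ltxx in tt'.
- have ta : t' != a by rewrite gt_eqF.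
  by have := es' _ ts' ta; rewrite ger0_norm ?subr_ge0 ?(ltW tt')// => ->; rewrite orbT.
- have ta : t != a by rewrite lt_eqF.
  by have := es' _ ts ta; rewrite distrC ger0_norm ?subr_ge0 ?(ltW tt')// => ->; rewrite orbT.
- by rewrite es.
Qed.

(** * Multiplicity bounded by length *)

Section multiplicity_length.
Context {R : realType} {X : metricType R}.
Local Notation H1 := (@hausdorff1 R X).
Local Notation cara := (caratheodory_measurable H1).

Lemma hausdorff1_bigcup_cvg (B : nat -> set X) : (forall n, cara (B n)) ->
  nondecreasing_seq B -> H1 \o B @ \oo --> H1 (\bigcup_n B n).
Proof.
move=> cB ndB.
have [[x _]|B0] := pselect (\bigcup_n B n !=set0); last first.
  have E (n : nat) : B n = set0.
    by rewrite -subset0 => x Bx; apply: B0; exists x; exists n.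
  rewrite (_ : \bigcup_n B n = set0) ?bigcup0//.
  have -> : H1 \o B = cst (H1 set0) by apply/funext => n /=; rewrite E.
  exact: cvg_cst.
pose nu : {outer_measure set (pointed_at x) -> \bar R} := @hausdorff1 R X.
exact: (@nondecreasing_cvg_mu _ (caratheodory_type nu) R nu B cB
  (caratheodory_measurable_bigcup cB) ndB).
Qed.

Variables (g : R -> X) (L : R).
Hypothesis L0 : 0 <= L.
Hypothesis gL : forall t t', mdist (g t) (g t') <= L * `|t' - t|.

(** At least [j] preimages. Times are taken in [0, 1[ to match the half-open arcs and to count the
    base point of a loop once. *)
Definition has_preimages j : set X := [set x | exists ss : seq R,
  [/\ size ss = j, uniq ss & forall t, t \in ss -> 0 <= t < 1 /\ g t = x]].

(** The three intervals are subdivided separately, so that no arc straddles [t0] or [t1] and the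
    length of the middle one can be isolated. *)
Let blocks t0 t1 k : seq (set X) :=
  arcs g (subdivision 0 t0 k) k.+1 ++
  (arcs g (subdivision t0 t1 k) k.+1 ++ arcs g (subdivision t1 1 k) k.+1).

Let cg : continuous g := lipschitz_curve_continuous gL.

Let cara_blocks t0 t1 k A : A \in blocks t0 t1 k -> cara A.
Proof.
by rewrite !mem_cat => /or3P[]; exact: caratheodory_arcs.
Qed.

Let sum_arcs a b k : a <= b ->
  (\sum_(A <- arcs g (subdivision a b k) k.+1) H1 A <= path_length a b g)%E.
Proof.
move=> ab; have := path_length_partition L0 gL k.+1 (fun i => subdivision_le k i ab).
rewrite subdivision0 subdivision_last; apply: le_trans.
rewrite /arcs big_map; apply: lee_sum => i _.
by apply: (hausdorff1_arc_le L0 gL); exact: subdivision_le.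
Qed.

Let le_hits_blocks t0 t1 k (ss : seq R) x (e : R) :
  0 <= t0 -> t0 <= t1 -> t1 <= 1 -> k.+1%:R^-1 < e -> uniq ss ->
  (forall t, t \in ss -> 0 <= t < 1 /\ g t = x) ->
  (forall t t', t \in ss -> t' \in ss -> t < t' -> e <= t' - t) ->
  (size ss <= hits (blocks t0 t1 k) x)%N.
Proof.
move=> t00 t01 t11 ke us ssx sep.
have sub a b : 0 <= a -> a <= b -> b <= 1 ->
    (count (fun t => (a <= t) && (t < b))%R ss <=
      hits (arcs g (subdivision a b k) k.+1) x)%N.
  move=> a0 ab b1.
  have := @count_le_hits _ _ g (subdivision a b k) k.+1 ss x e.
  rewrite subdivision0 subdivision_last; apply => //.
  - by move=> i; exact: subdivision_le.
  - move=> i; rewrite subdivisionS; apply: le_lt_trans ke.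
    by rewrite ler_piMl ?invr_ge0//; lra.
  - by move=> t /ssx[].
rewrite /hits !count_cat.
apply: leq_trans (leq_add (sub _ _ (lexx 0) t00 (le_trans t01 t11))
  (leq_add (sub _ _ t00 t01 t11) (sub _ _ (le_trans t00 t01) t11 (lexx 1)))).
elim: ss {us sep sub} ssx => //= t ss IH ssx.
have {}IH := IH (fun t' h => ssx t' (mem_behead (s := t :: ss) h)).
have [/andP[tge0 tlt1] _] := ssx t (mem_head _ _).
rewrite tge0 tlt1 /= andbT.
by case: (ltP t t0) => h1; case: (ltP t t1) => h2 /=; lia.
Qed.

(** Layers 1, 2 and 3 of a fine subdivision have total measure at most the length. The third layer
    is kept to detect points of multiplicity above 2. *)
Lemma length_multiplicity t0 t1 : 0 <= t0 -> t0 <= t1 -> t1 <= 1 ->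
  (H1 (has_preimages 2) + H1 (has_preimages 2) + H1 (has_preimages 3) <=
    path_length 0 t0 g + path_length t0 t1 g + path_length t1 1 g)%E.
Proof.
move=> t00 t01 t11; set len := (X in (_ <= X)%E).
(* Subdivisions for different [k] are not nested, so the layers need not be monotone. Intersecting
   over all k >= n gives increasing sets, to which continuity from below applies. *)
pose U j n := \bigcap_(k in [set k | (n <= k)%N]) hit_atleast j (blocks t0 t1 k).
have cU j n : cara (U j n).
  rewrite /U -[X in cara X]setCK setC_bigcap; apply: caratheodory_measurable_setC.
  rewrite bigcup_mkcond; apply: caratheodory_measurable_bigcup => k.
  case: ifP => _; last exact: caratheodory_measurable_set0.
  apply: caratheodory_measurable_setC; apply: caratheodory_hit_atleast.
  exact: cara_blocks.
have ndU j : nondecreasing_seq (U j).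
  move=> m n mn; apply/subsetPset => x Ux k /= nk.
  by apply: Ux => /=; exact: leq_trans nk.
have preU j : has_preimages j `<=` \bigcup_n U j n.
  move=> x [ss [<- us ssx]]; have [e e0 sep] := uniq_gap ss.
  have [n] := ltr_add_invr e0; rewrite add0r => ne; exists n => // k /= nk.
  apply: le_hits_blocks sep => //; apply: le_lt_trans ne.
  by rewrite lef_pV2 ?posrE// ler_nat.
have bound n : (H1 (U 2%N n) + H1 (U 2%N n) + H1 (U 3%N n) <= len)%E.
  have US j : U j n `<=` hit_atleast j (blocks t0 t1 n) by move=> x; apply => /=.
  (* Layer 1 contains layer 2, whence the second copy of the latter. *)
  have := sum_hit_atleast 3 (@cara_blocks t0 t1 n).
  rewrite !big_ord_recr big_ord0 /= add0e => sumH.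
  apply: (@le_trans _ _ (\sum_(A <- blocks t0 t1 n) H1 A)%E).
    apply: le_trans sumH; rewrite !leeD//; apply: le_hausdorff1; try exact: US.
    by apply: subset_trans (US 2) _; exact: hit_atleastS.
  rewrite /blocks !big_cat/= addeA /len.
  by rewrite !leeD// sum_arcs.
apply: (@le_trans _ _ (H1 (\bigcup_n U 2%N n) + H1 (\bigcup_n U 2%N n) + H1 (\bigcup_n U 3%N n))%E).
  by rewrite !leeD//; apply: le_hausdorff1; exact: preU.
have cvgU j := hausdorff1_bigcup_cvg (cU j) (@ndU j).
have def (a b : \bar R) : (0 <= a)%E -> (0 <= b)%E -> (a +? b)%E by exact: ge0_adde_def.
have cvg3 : (fun n => H1 (U 2%N n) + H1 (U 2%N n) + H1 (U 3%N n))%E @ \oo -->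
    (H1 (\bigcup_n U 2%N n) + H1 (\bigcup_n U 2%N n) + H1 (\bigcup_n U 3%N n))%E.
  apply: cvgeD; last exact: (cvgU 3%N).
    by apply: def; rewrite ?adde_ge0 ?hausdorff1_ge0.
  by apply: cvgeD; [apply: def; exact: hausdorff1_ge0|exact: (cvgU 2%N)..].
rewrite -(cvg_lim _ cvg3)//; apply: lime_le; last by apply: nearW => n; exact: bound.
by apply/cvg_ex; eexists; exact: cvg3.
Qed.

End multiplicity_length.

Lemma hausdorff1_set1 (R : realType) (X : metricType R) (x : X) :
  hausdorff1 [set x] = 0%E.
Proof.
apply/eqP; rewrite eq_le hausdorff1_ge0 andbT; apply: hausdorff1_le => d d0.
have diam1 (i : nat) : diam (if i == 0%N then [set x] else set0) = 0%E.
  case: eqP => _; last exact: diam0.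
  apply/eqP; rewrite eq_le diam_ge0 andbT; apply: diam_le => // _ _ -> ->.
  by rewrite mdistxx.
apply: le_trans (hausdorff1_preP (F := fun i => if i == 0%N then [set x] else set0) _ _) _.
- by move=> _ ->; exists 0%N.
- by move=> i; rewrite diam1 lee_fin ltW.
- by rewrite eseries0.
Qed.

Lemma counting_set2 (T : choiceType) (R : realType) (s t : T) : s != t ->
  counting [set s; t] = 2%:E :> \bar R.
Proof.
move=> st; rewrite /counting asboolT; last exact: finite_set2.
by rewrite fset_setU//= !fset_set1 finmap.cardfs2 st.
Qed.

Theorem theorem4p4 (R : realType) (X : metricType R)
  (hX : continuum X) (hfin : (hausdorff1 [set: X] < +oo)%E) :
  exists gamma : R -> X,
    is_path 0 1 gamma /\
    [/\ closed_path 0 1 gamma, lipschitz_path 0 1 gamma,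
        gamma @` `[0, 1] = [set: X] & degree_zero 0 1 gamma] /\
    (hausdorff1 [set x : X | multiplicity 0 1 gamma x <> 2%:E] = 0%E /\
     path_length 0 1 gamma = (2%:E * hausdorff1 [set: X])%E) /\
    constant_speed 0 1 gamma (2 * fine (hausdorff1 [set: X])).
Proof.
case: hX => -[y0 _] conX cX.
have [g [gL g01 gsurj traps]] := limit_loop cX conX hfin y0.
set L : R := 2 * _ in gL traps *.
have EH : hausdorff1 [set: X] = (fine (hausdorff1 [set: X]))%:E.
  by rewrite fineK// fin_num_hausdorff1.
have L0 : 0 <= L by rewrite mulr_ge0// fine_ge0// hausdorff1_ge0.
have [E [E0 Emult]] := multiple_points L0 gL traps cX.
(* The base point g 0 = g 1 is discarded too, so that the remaining points have all their preimages
   inside ]0, 1[. *)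
have E'0 : hausdorff1 (E `|` [set g 0]) = 0%E.
  apply/eqP; rewrite eq_le hausdorff1_ge0 andbT.
  by apply: le_trans (outer_measureU2 _ _ _) _; rewrite /= E0 hausdorff1_set1 adde0.
have twice x : ~ (E `|` [set g 0]) x -> exists st : R * R,
    [/\ st.1 != st.2, 0 < st.1 < 1, 0 < st.2 < 1, g st.1 = x & g st.2 = x].
  move=> nEx.
  have inner t : t \in `[0, 1] -> g t = x -> 0 < t < 1.
    rewrite in_itv/= !lt_neqAle => /andP[-> ->] gt; rewrite !andbT.
    apply/andP; split; apply: contra_not_neq nEx => tE; right.
      by rewrite -gt -tE.
    by rewrite g01 -tE gt.
  have [t t01 gt] := gsurj x; have /andP[t0 t1] := inner t t01 gt.
  have [|s s01 [gs st]] := Emult t t0 t1; first by rewrite gt => Ex; apply: nEx; left.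
  exists (s, t); split=> //=; [|by rewrite t0|by rewrite gs].
  by apply: inner => //; rewrite gs.
have H2 : (hausdorff1 [set: X] <= hausdorff1 (has_preimages g 2))%E.
  have sub : [set: X] `<=` (E `|` [set g 0]) `|` has_preimages g 2.
    move=> x _; have [?|/twice[[s t] /= [st /andP[s0 s1] /andP[t0 t1] gs gt]]] := 
      pselect ((E `|` [set g 0]) x); first by left.
    right; exists [:: s; t]; split => //=; first by rewrite inE st.
    by move=> u; rewrite !inE => /orP[]/eqP ->; rewrite ltW//.
  apply: le_trans (le_hausdorff1 sub) _.
  by apply: le_trans (outer_measureU2 _ _ _) _; rewrite /= E'0 add0e.
(* Only the outer pieces are bounded by the Lipschitz constant. For t0 = 0 and t1 = 1 this forces
   the third layer to be null; for other times the middle piece must have length at least L(t1 -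
   t0). *)
have tight t0 t1 : 0 <= t0 -> t0 <= t1 -> t1 <= 1 ->
    (L%:E + hausdorff1 (has_preimages g 3) <= (L * t0)%:E +
      path_length t0 t1 g + (L * (1 - t1))%:E)%E.
  move=> t00 t01 t11; have := length_multiplicity L0 gL t00 t01 t11.
  have l0 := path_length_le L0 gL t00; have l1 := path_length_le L0 gL t11.
  rewrite subr0 in l0.
  move=> h; apply: le_trans (leeD (leeD l0 (lexx _)) l1); apply: le_trans h.
  by rewrite leeD// /L mulrDl mul1r EFinD -EH leeD.
have H3 : hausdorff1 (has_preimages g 3) = 0%E.
  have := tight 0 1 (lexx _) ler01 (lexx _); rewrite subrr !mulr0 add0e adde0.
  move=> /le_trans/(_ (path_length_le L0 gL ler01)).
  rewrite subr0 mulr1 -[leRHS]adde0 leeD2lE// => h.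
  by apply/eqP; rewrite eq_le h hausdorff1_ge0.
have speed : constant_speed 0 1 g L.
  move=> t0 t1 t00 t01 t11; apply/eqP; rewrite eq_le path_length_le//=.
  have := tight _ _ t00 t01 t11; rewrite H3 adde0.
  rewrite -(fineK (path_length_fin_num L0 gL t01)) -!EFinD !lee_fin.
  by move: (fine _) => l; lra.
exists g; split; first exact: continuous_subspaceT (lipschitz_curve_continuous gL).
split; [split => //|split; [split|exact: speed]].
- by exists L => s t _ _; exact: gL.
- by apply/seteqP; split=> // x _; have [t] := gsurj x; exists t.
- exact: traps_degree_zero traps.
- apply/eqP; rewrite eq_le hausdorff1_ge0 andbT.
  have sub : [set x | multiplicity 0 1 g x <> 2%:E] `<=`
      (E `|` [set g 0]) `|` has_preimages g 3.
    move=> x /= mx; apply: contrapT => /not_orP[nEx n3]; apply: mx.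
    have [[s t] /= [st s01 t01 gs gt]] := twice x nEx.
    rewrite /multiplicity (_ : _ `&` _ = [set s; t]) ?counting_set2//.
    apply/seteqP; split=> [u [/= u01 gu]|u [|] -> /=]; last 2 first.
    + by move: s01 => /andP[? ?]; rewrite in_itv/= !ltW.
    + by move: t01 => /andP[? ?]; rewrite in_itv/= !ltW.
    apply: contrapT => /not_orP[us ut]; apply: n3; exists [:: s; t; u]; split=> //=.
      by rewrite !inE negb_or st/= andbT; apply/andP; split; apply/eqP => ?; [apply: us|apply: ut].
    move=> v; rewrite !inE => /or3P[]/eqP ->; rewrite ?gs ?gt ?gu; split=> //.
    + by case/andP: s01 => /ltW ->.
    + by case/andP: t01 => /ltW ->.
    (* A third preimage at time 1 is excluded: the point would be the base point, already
       discarded. *)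
    + move: u01; rewrite in_itv/= => /andP[-> u1]; rewrite lt_neqAle u1 andbT/=.
      by apply/eqP => uE; apply: nEx; right; rewrite g01 -uE gu.
  apply: le_trans (le_hausdorff1 sub) _.
  by apply: le_trans (outer_measureU2 _ _ _) _; rewrite /= E'0 H3 adde0.
- by rewrite speed// subr0 mulr1 EFinM -EH.
Qed.
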